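(* Let $n,m\ge 0$ be integers, let $p,q\in\mathbb C$ with $0<|p|,|q|<1$, and let $z=(z_1,\dots,z_n)$, $y=(y_1,\dots,y_m)$, $t=(t_1,\dots,t_{2n+2m+4})$ be variables in $\mathbb C^*$ subject to the single constraint (balancing condition) $$\prod_{r=1}^{2n+2m+4}t_r=(pq)^{m+1}.$$ Let $$ \rho(z,y;t;p,q)=\prod_{1\leq r<s\leq 2n+2m+4}\frac{1}{\Gamma_{p,q}(t_rt_s)}\cdot \frac{\Delta_n(z;t;p,q)}{\Delta_m\big(y/\sqrt{pq};\sqrt{pq}/t;p,q\big)}, $$ where $y/\sqrt{pq}=(y_j/\sqrt{pq})_j$, $\sqrt{pq}/t=(\sqrt{pq}/t_r)_r$; explicitly, $$ \rho(z,y;t;p,q)=\prod_{1\leq r<s\leq 2n+2m+4}\frac{1}{\Gamma_{p,q}(t_rt_s)}\cdot \frac{\prod_{1\leq i<j\leq m}\Gamma_{p,q}\left(\frac{y_iy_j}{pq},\frac{pq}{y_iy_j},\frac{y_i}{y_j},\frac{y_j}{y_i}\right)}{\prod_{1\leq i<j\leq n}\Gamma_{p,q}(z_i^{\pm 1}z_j^{\pm 1})} \cdot\frac{\prod_{j=1}^m\Gamma_{p,q}\left(\frac{y_j^2}{pq},\frac{pq}{y_j^2}\right)}{\prod_{j=1}^n\Gamma_{p,q}(z_j^{\pm 2})} \prod_{r=1}^{2n+2m+4}\frac{\prod_{j=1}^n\Gamma_{p,q}(t_rz_j^{\pm 1})}{\prod_{j=1}^m\Gamma_{p,q}\left(\frac{y_j}{t_r},\frac{pq}{t_ry_j}\right)}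 . $$ Then $\rho$ is a totally elliptic hypergeometric term. That is, eliminating $t_{2n+2m+4}=(pq)^{m+1}/\prod_{r=1}^{2n+2m+3}t_r$ and regarding $\rho$ as a function of the independent variables $x=(z_1,\dots,z_n,y_1,\dots,y_m,t_1,\dots,t_{2n+2m+3})$, for every independent variable $x_a$ the $q$-certificate $$h_a(x;q;p)=\frac{\rho(\dots,qx_a,\dots)}{\rho(\dots,x_a,\dots)}$$ is a meromorphic function that is $p$-elliptic in each of the independent variables and in $q$: it is invariant under $x_b\mapsto px_b$ for every independent variable $x_b$ (the other independent variables and $q$ being fixed), and under $q\mapsto pq$ (all independent variables being fixed).
   Context: For $0<|p|,|q|<1$ and $z\in\mathbb C^*$, the elliptic gamma function is $$\Gamma_{p,q}(z)=\prod_{j,k=0}^\infty\frac{1-z^{-1}p^{j+1}q^{k+1}}{1-zp^{j}q^{k}}.$$ It satisfies $\Gamma_{p,q}(qz)=\theta_p(z)\Gamma_{p,q}(z)$, where $\theta_p(x)=\prod_{j\ge0}(1-xp^j)(1-x^{-1}p^{j+1})$. Conventions: $\Gamma_{p,q}(a_1,\dots,a_k)=\prod_{i=1}^k\Gamma_{p,q}(a_i)$; $\Gamma_{p,q}(az^{\pm1})=\Gamma_{p,q}(az)\Gamma_{p,q}(az^{-1})$; $\Gamma_{p,q}(z^{\pm2})=\Gamma_{p,q}(z^2)\Gamma_{p,q}(z^{-2})$; $\Gamma_{p,q}(z_i^{\pm1}z_j^{\pm1})=\Gamma_{p,q}(z_iz_j)\Gamma_{p,q}(z_iz_j^{-1})\Gamma_{p,q}(z_i^{-1}z_j)\Gamma_{p,q}(z_i^{-1}z_j^{-1})$.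 Empty products equal $1$. A fixed branch of $\sqrt{pq}$ is used throughout; the explicit form of $\rho$ does not contain it. With $2n+2m+4$ parameters $t_i$, the kernel of the type I $BC_n$ elliptic hypergeometric integral is $$ \Delta_n(z;t;p,q)=\prod_{1\leq i<j\leq n} \frac{1}{\Gamma_{p,q}(z_i^{\pm 1}z_j^{\pm 1})} \prod_{j=1}^n\frac{\prod_{i=1}^{2n+2m+4}\Gamma_{p,q}(t_iz_j^{\pm 1})}{\Gamma_{p,q}(z_j^{\pm 2})}, $$ and $\Delta_m$ is given by the same formula with $m$ variables and the same number $2n+2m+4$ of parameters. A function $\Delta$ of independent variables $x_1,\dots,x_N\in\mathbb C^*$ (built from elliptic gamma functions with bases $p,q$) is called a totally elliptic hypergeometric term if all its $q$-certificates $h_a(x;q;p)=\Delta(\dots,qx_a,\dots)/\Delta(x)$, $a=1,\dots,N$, are $p$-elliptic functions of all the variables $x_1,\dots,x_N$ and of $q$; a meromorphic function is $p$-elliptic in a variable if it is unchanged when that variable is multiplied by $p$ and the other independent variables are fixed. (The certificates are finite products of functions $\theta_p$ of monomials in $x_1,\dots,x_N,q,p$ and their inverses, times monomials.) *)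

(* Defs.v *)
(* MathComp-Analysis; the complex field is R[i] for an abstract R : realType,
   and R[i]^o is R[i] seen as a normed module over itself. *)
From HB Require Import structures.
From mathcomp Require Import all_boot all_order all_algebra.
From mathcomp Require Import complex.
From mathcomp Require Import all_classical all_reals all_analysis.
From mathcomp Require Import ring.

Set Implicit Arguments.
Unset Strict Implicit.
Unset Printing Implicit Defensive.

Import Order.TTheory GRing.Theory Num.Theory numFieldNormedType.Exports.

Local Open Scope classical_set_scope.
Local Open Scope ring_scope.
Local Open Scope complex_scope.

Section Meromorphic.
Variables (R : realType) (V : normedModType R[i]).
Implicit Types (D U : set V) (f : V -> R[i]^o).

Definition holomorphic_on U f : Prop :=
  open U /\ forall u, U u -> differentiable f u.

(* The second condition says that f vanishes identically on no nonempty open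
   subset of U, i.e. on no connected component of U. *)
Definition nondegenerate_on U f : Prop :=
  holomorphic_on U f /\ U `<=` closure [set v | f v != 0].

(* P holds on D off a thin analytic subset, i.e. off a set locally contained in
   the zero set of a holomorphic function that is not locally zero.  Since such
   sets are closed under finite unions and have dense complement, equality of
   meromorphic functions is [generically D (fun u => f u = g u)]. *)
Definition generically D (P : V -> Prop) : Prop :=
  forall u, D u -> exists (U : set V) (g : V -> R[i]^o),
    [/\ U u, nondegenerate_on U g & forall v, U v -> g v != 0 -> P v].

(* f is locally a quotient of holomorphic functions.  The values of f on the
   zero set of the local denominator are ignored: there they are artefacts of
   the convention x / 0 = 0. *)
Definition meromorphic_on D f : Prop :=
  forall u, D u -> exists (U : set V) (g h : V -> R[i]^o),
    [/\ U u, holomorphic_on U g, nondegenerate_on U h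
      & forall v, U v -> h v != 0 -> f v = g v / h v].

End Meromorphic.

Section TotallyElliptic.
Variables (R : realType) (N : nat).

(* Points (x, q); the base p is a fixed parameter. *)
Notation point := ('rV[R[i]]_N * R[i]^o)%type.

Definition term_domain : set point :=
  [set u : point | (forall b, u.1 0 b != 0) /\ 0 < `|u.2| < 1].

Definition scale_var (b : 'I_N) (c : R[i]) (x : 'rV[R[i]]_N) : 'rV[R[i]]_N :=
  \row_j (if j == b then c * x 0 j else x 0 j).

Definition certificate (Delta : 'rV[R[i]]_N -> R[i] -> R[i]) (a : 'I_N)
    (u : point) : R[i]^o :=
  Delta (scale_var a u.2 u.1) u.2 / Delta u.1 u.2.

(* The first condition makes the quotients defining the certificates
   meaningful.  In the last one, q is replaced by p q in every occurrence,
   including the shift of the a-th variable. *)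
Definition totally_elliptic_term (p : R[i])
    (Delta : 'rV[R[i]]_N -> R[i] -> R[i]) : Prop :=
  generically term_domain (fun u => Delta u.1 u.2 != 0) /\
  forall a : 'I_N,
    [/\ meromorphic_on term_domain (certificate Delta a),
        forall b : 'I_N, generically term_domain (fun u =>
          certificate Delta a (scale_var b p u.1, u.2)
          = certificate Delta a u)
      & generically term_domain (fun u =>
          certificate Delta a (u.1, p * u.2) = certificate Delta a u)].

End TotallyElliptic.

Section EllipticGamma.
Variable R : realType.
Implicit Types p q z : R[i].

(* The double product converges absolutely, so the limit of its square partial
   products is its value.  At the poles of the elliptic gamma function the
   partial products are eventually 0, since x / 0 = 0. *)
Definition egamma p q z : R[i] :=
  lim ((fun M : nat => \prod_(j < M) \prod_(k < M)
     ((1 - z^-1 * p ^+ j.+1 * q ^+ k.+1) / (1 - z * p ^+ j * q ^+ k)) : R[i]^o)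
   @ \oo).

Definition egamma_pm p q (a z : R[i]) : R[i] :=
  egamma p q (a * z) * egamma p q (a * z^-1).

Definition egamma_pm2 p q z : R[i] :=
  egamma p q (z ^+ 2) * egamma p q (z ^- 2).

Definition egamma_pmpm p q (w z : R[i]) : R[i] :=
  egamma p q (w * z) * egamma p q (w * z^-1)
  * egamma p q (w^-1 * z) * egamma p q (w^-1 * z^-1).

(* Kernel of the type I BC_n integral with n variables and k parameters. *)
Definition kernel_BC (n k : nat) (z : 'I_n -> R[i]) (t : 'I_k -> R[i]) p q
    : R[i] :=
  (\prod_(i < n) \prod_(j < n | (i < j)%N) (egamma_pmpm p q (z i) (z j))^-1)
  * \prod_(j < n)
      ((\prod_(i < k) egamma_pm p q (t i) (z j)) / egamma_pm2 p q (z j)).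

(* [sqrtC] is a fixed branch of the square root; by [rho_explicit] below the
   choice of branch is irrelevant. *)
Definition rho (n m k : nat) (z : 'I_n -> R[i]) (y : 'I_m -> R[i])
    (t : 'I_k -> R[i]) p q : R[i] :=
  (\prod_(r < k) \prod_(s < k | (r < s)%N) (egamma p q (t r * t s))^-1)
  * (kernel_BC z t p q
     / kernel_BC (fun j => y j / sqrtC (p * q)) (fun r => sqrtC (p * q) / t r)
         p q).

(* t_1, ..., t_k completed by the last parameter so that the product is c. *)
Definition balanced (k : nat) (c : R[i]) (t : 'rV[R[i]]_k) (r : 'I_k.+1)
    : R[i] :=
  if unlift ord_max r is Some s then t 0 s else c / \prod_(s < k) t 0 s.

Lemma balancedE (k : nat) (c : R[i]) (t : 'rV[R[i]]_k) :
  (forall s, t 0 s != 0) -> \prod_(r < k.+1) balanced c t r = c.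
Proof.
move=> t0; rewrite big_ord_recr /= {2}/balanced unlift_none.
rewrite (eq_bigr (fun s => t 0 s)) => [|s _].
  by rewrite mulrC divfK// prodf_seq_neq0; apply/allP => s _; rewrite t0.
rewrite /balanced (_ : widen_ord _ _ = lift ord_max s) ?liftK//.
by apply: val_inj; rewrite /= /bump leqNgt ltn_ord.
Qed.

(* rho in the independent variables
   x = (z_1, ..., z_n, y_1, ..., y_m, t_1, ..., t_(2n+2m+3)). *)
Definition rho_indep (n m : nat) p
    (x : 'rV[R[i]]_(n + m + (2 * n + 2 * m + 3))) q : R[i] :=
  rho (fun i => lsubmx (lsubmx x) 0 i) (fun j => rsubmx (lsubmx x) 0 j)
    (balanced ((p * q) ^+ m.+1) (rsubmx x)) p q.

Lemma rho_explicit (n m k : nat) (z : 'I_n -> R[i]) (y : 'I_m -> R[i])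
    (t : 'I_k -> R[i]) p q : p != 0 -> q != 0 ->
  let G := egamma p q in
  rho z y t p q =
  (\prod_(r < k) \prod_(s < k | (r < s)%N) (G (t r * t s))^-1)
  * ((\prod_(i < m) \prod_(j < m | (i < j)%N)
        (G (y i * y j / (p * q)) * G (p * q / (y i * y j))
         * G (y i / y j) * G (y j / y i)))
     / \prod_(i < n) \prod_(j < n | (i < j)%N) egamma_pmpm p q (z i) (z j))
  * ((\prod_(j < m) (G (y j ^+ 2 / (p * q)) * G (p * q / y j ^+ 2)))
     / \prod_(j < n) egamma_pm2 p q (z j))
  * \prod_(r < k) ((\prod_(j < n) egamma_pm p q (t r) (z j))
     / \prod_(j < m) (G (y j / t r) * G (p * q / (t r * y j)))).
Proof.
move=> p0 q0 G; rewrite /rho; set c := sqrtC (p * q).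
have c2 : p * q = c * c by rewrite -expr2 /c sqrtCK.
have c0 : c != 0 by rewrite sqrtC_eq0 mulf_neq0.
have e1 a b : c / a * (b / c) = b / a.
  by rewrite mulf_div [a * c]mulrC -mulf_div divff // mul1r.
have e2 a b : a / c * (c / b) = a / b by rewrite mulrA divfK.
have kE n' (z' : 'I_n' -> R[i]) (t' : 'I_k -> R[i]) : kernel_BC z' t' p q =
    (\prod_(r < k) \prod_(j < n') egamma_pm p q (t' r) (z' j))
    / ((\prod_(i < n') \prod_(j < n' | (i < j)%N)
          egamma_pmpm p q (z' i) (z' j))
       * \prod_(j < n') egamma_pm2 p q (z' j)).
  rewrite /kernel_BC prodf_div exchange_big /= invfM mulrCA.
  congr (_ * (_ * _)); rewrite -prodfV; apply: eq_bigr => i _.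
  exact: prodfV.
rewrite !kE prodf_div invf_div.
have -> : \prod_(r < k) \prod_(j < m) egamma_pm p q (c / t r) (y j / c) =
    \prod_(r < k) \prod_(j < m) (G (y j / t r) * G (p * q / (t r * y j))).
  apply: eq_bigr => r _; apply: eq_bigr => j _; rewrite /egamma_pm c2 invf_div.
  by rewrite e1 mulf_div.
have -> : \prod_(i < m) \prod_(j < m | (i < j)%N)
      egamma_pmpm p q (y i / c) (y j / c) =
    \prod_(i < m) \prod_(j < m | (i < j)%N)
        (G (y i * y j / (p * q)) * G (p * q / (y i * y j))
         * G (y i / y j) * G (y j / y i)).
  apply: eq_bigr => i _; apply: eq_bigr => j _.
  rewrite /egamma_pmpm c2 !invf_div e1 e2 !mulf_div -/G.
  by ring.
have -> : \prod_(j < m) egamma_pm2 p q (y j / c) =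
    \prod_(j < m) (G (y j ^+ 2 / (p * q)) * G (p * q / y j ^+ 2)).
  apply: eq_bigr => j _.
  by rewrite /egamma_pm2 c2 !expr2 mulf_div invf_div.
rewrite invfM; ring.
Qed.

End EllipticGamma.

Arguments rho_indep {R} n m p x q.

(* Main.v *)
(* Write rho as a product of Gamma(M_i)^{e_i}, with e_i = 1 or -1 and
   M_i = x^{al_i} (p q)^{be_i} a Laurent monomial in the independent variables.
   Since Gamma(q z) = theta_p(z) Gamma(z), the certificate h_a is generically a
   product of functions theta_p of monomials, and
   theta_p(p^j z) = (-1)^j z^{-j} p^{-j(j-1)/2} theta_p(z) for every integer j.
   Hence x_b -> p x_b and q -> p q multiply h_a by a monomial in x, q, p up to
   sign.  Its exponents vanish because, writing S for the sum over i weighted by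
   e_i,
     S(al_a al_b al_c) = 0,  2 S(be al_a al_b) = S(al_a al_b),
     S(be^2 al_a) = S(be al_a),  S(al_a) = 0,
   and the sign is 1 by two parity conditions.  These identities are checked
   with all the exponents of t_1, ..., t_{2n+2m+4} treated symmetrically, using
   only that the t_r multiply to (p q)^{m+1}.
   The function (z; p)_oo is differentiable because the partial products satisfy
   a second order Taylor estimate that is uniform in the number of factors. *)
Require Import Defs.
From mathcomp Require Import all_boot all_order all_algebra.
From mathcomp Require Import complex.
From mathcomp Require Import all_classical all_reals all_analysis.
From mathcomp Require Import ring lra zify.

Set Implicit Arguments.
Unset Strict Implicit.
Unset Printing Implicit Defensive.

Import Order.TTheory GRing.Theory Num.Theory numFieldNormedType.Exports.

Local Open Scope classical_set_scope.
Local Open Scope ring_scope.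
Local Open Scope complex_scope.

(** * The modulus of a complex number as a real number *)

Section ComplexModulus.
Variable R : realType.
Implicit Types z w : R[i].

(** [egamma] is a limit of quotients with x / 0 = 0, so the shift equation of Gamma is handled off
    its zeros and poles. For one monomial these are infinitely many hypersurfaces, but only finitely
    many meet a small neighbourhood of a point of the domain, since |p| and |q| stay below a
    constant less than 1 there; this makes avoiding them a generic condition. Each hypersurface is
    thin because the monomial has a nonzero exponent at some independent variable, a property
    preserved by multiplication by powers of p and q. Analyticity enters through theta and the
    monomials: the certificate is exchanged for an explicit theta product, whose invariance then
    holds at every point of the domain. The exponents to be cancelled are cubic because the
    multiplier of theta is quadratic in its shift and a certificate contains runs of consecutive
    thetas, along which these exponents are summed. *)

Definition nc z : R := complex.Re `|z|.

(** The norm of R[i] takes values in R[i], whose order is partial; estimates are carried out in R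
    through [nc]. *)
Lemma ncE z : `|z| = (nc z)%:C.
Proof. by rewrite /nc RRe_real// normr_real. Qed.

Lemma nc_ge0 z : 0 <= nc z.
Proof. by rewrite -ler0c -ncE. Qed.

Lemma nc0 : nc 0 = 0.
Proof. by apply: complexI; rewrite -ncE normr0. Qed.

Lemma nc1 : nc 1 = 1.
Proof. by apply: complexI; rewrite -ncE normr1. Qed.

Lemma nc_eq0 z : (nc z == 0) = (z == 0).
Proof. by rewrite -(inj_eq (@complexI R)) -ncE normr_eq0. Qed.

Lemma nc_gt0 z : (0 < nc z) = (z != 0).
Proof. by rewrite lt_def nc_ge0 nc_eq0 andbT. Qed.

Lemma ncD z w : nc (z + w) <= nc z + nc w.
Proof. by rewrite -lecR rmorphD/= -!ncE ler_normD. Qed.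

Lemma ncN z : nc (- z) = nc z.
Proof. by apply: complexI; rewrite -!ncE normrN. Qed.

Lemma ncB z w : nc (z - w) <= nc z + nc w.
Proof. by rewrite -(ncN w) ncD. Qed.

Lemma ncBC z w : nc (z - w) = nc (w - z).
Proof. by rewrite -ncN opprB. Qed.

Lemma ncM z w : nc (z * w) = nc z * nc w.
Proof. by apply: complexI; rewrite rmorphM/= -!ncE normrM. Qed.

Lemma ncV z : nc z^-1 = (nc z)^-1.
Proof. by apply: complexI; rewrite fmorphV/= -!ncE normfV. Qed.

Lemma ncX z n : nc (z ^+ n) = nc z ^+ n.
Proof. by apply: complexI; rewrite rmorphXn/= -!ncE normrX. Qed.

Lemma nc_real (x : R) : 0 <= x -> nc x%:C = x.
Proof. by move=> x0; apply: complexI; rewrite -ncE ger0_norm// ler0c. Qed.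

Lemma nc_Re z : `|complex.Re z| <= nc z.
Proof. by rewrite -lecR -ncE normc_ge_Re. Qed.

Lemma nci : nc 'i%C = 1.
Proof.
by apply: complexI; rewrite -ncE normc_def/= expr0n expr1n add0r sqrtr1.
Qed.

Lemma nc_Im z : `|complex.Im z| <= nc z.
Proof.
have := nc_Re (- z * 'i%C).
by rewrite ReiNIm ncM nci mulr1 ncN; case: z => a b /=; rewrite opprK.
Qed.

Lemma nc_ReIm z : nc z <= `|complex.Re z| + `|complex.Im z|.
Proof.
have h (x : R) : nc x%:C = `|x|.
  have [x0|x0] := leP 0 x; first by rewrite nc_real// ger0_norm.
  by rewrite -ncN -rmorphN/= nc_real ?ltr0_norm// oppr_ge0 ltW.
by rewrite {1}[z]complexE (le_trans (ncD _ _))// ncM !h nci mul1r.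
Qed.

End ComplexModulus.

(** * Convergence and growth of sequences with geometric increments *)

Section ComplexConvergence.
Variable R : realType.
Implicit Types (u : nat -> R[i]^o) (K r : R).

(** An element e > 0 of R[i] has zero imaginary part, so radii taken in R are enough. *)
Lemma cvg_ncP (T : Type) (F : set_system T) {FF : Filter F} (f : T -> R[i]^o)
    (l : R[i]^o) :
  (forall e : R, 0 < e -> \forall t \near F, nc (f t - l) < e) -> f @ F --> l.
Proof.
move=> h; apply/cvgrPdist_lt => e e0.
have /andP[ei er] : (complex.Im e == 0) && (0 < complex.Re e).
  by move: e0; rewrite ltcE /= eq_sym.
near=> t; rewrite ncE (_ : e = (complex.Re e)%:C).
  by rewrite ltcR ncBC; near: t; apply: h.
by rewrite RRe_real// ger0_real// ltW.
Unshelve. all: by end_near. Qed.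

Lemma nc_cvgP (T : Type) (F : set_system T) {FF : Filter F} (f : T -> R[i]^o)
    (l : R[i]^o) (e : R) :
  f @ F --> l -> 0 < e -> \forall t \near F, nc (f t - l) < e.
Proof.
move=> /cvgrPdist_lt h e0; have /h : 0 < e%:C :> R[i] by rewrite ltcR.
by apply: filterS => t; rewrite ncE ltcR ncBC.
Qed.

Lemma geometric_cvgR (a : nat -> R) K r : 0 <= r < 1 ->
  (forall n, `|a n.+1 - a n| <= K * r ^+ n) -> cvgn a.
Proof.
move=> /andP[r0 r1] h.
have : cvgn (series (telescope a)).
  apply: normed_cvg; apply: (series_le_cvg (v_ := geometric K r)) => //=.
  - by move=> n; apply: le_trans (h n); rewrite normr_ge0.
  - by apply: is_cvg_geometric_series; rewrite ger0_norm.
move=> /cvg_ex[/= l hl]; apply/cvg_ex; exists (l + a 0%N).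
rewrite [X in X @ _](_ : a = (series (telescope a)) \+ cst (a 0%N)).
  by apply: (cvgD hl); exact: cvg_cst.
by apply/funext => n /=; rewrite addrC -eq_sum_telescope.
Qed.

Lemma geometric_cvg u K r : 0 <= r < 1 ->
  (forall n, nc (u n.+1 - u n) <= K * r ^+ n) -> cvgn u.
Proof.
move=> hr h.
have /cvg_ex[/= a ha] : cvgn (fun n => complex.Re (u n)).
  apply: (geometric_cvgR hr) => n; apply: le_trans (h n).
  by apply: le_trans (nc_Re _); case: (u n) (u n.+1) => ? ? [].
have /cvg_ex[/= b hb] : cvgn (fun n => complex.Im (u n)).
  apply: (geometric_cvgR hr) => n; apply: le_trans (h n).
  by apply: le_trans (nc_Im _); case: (u n) (u n.+1) => ? ? [].
apply/cvg_ex; exists (a +i* b); apply: cvg_ncP => e e0.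
have e2 : 0 < e / 2 by rewrite divr_gt0.
near=> n; apply: le_lt_trans (nc_ReIm _) _.
rewrite (splitr e) ltrD//.
  have : `|a - complex.Re (u n)| < e / 2.
    by near: n; move/cvgrPdist_lt : ha; apply.
  by rewrite distrC; case: (u n).
have : `|b - complex.Im (u n)| < e / 2.
  by near: n; move/cvgrPdist_lt : hb; apply.
by rewrite distrC; case: (u n).
Unshelve. all: by end_near. Qed.

(** A discrete Gronwall inequality: 1 + a r^n is at most exp (a r^n), and the r^n sum to at most 1 /
    (1 - r). The bound is free of n; the uniform estimates on partial products rest on it. *)
Lemma geometric_growth (x : nat -> R) (a b r : R) :
  0 <= a -> 0 <= b -> 0 <= r < 1 -> (forall n, 0 <= x n) ->
  (forall n, x n.+1 <= x n * (1 + a * r ^+ n) + b * r ^+ n) ->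
  forall n, x n <= (x 0%N + b / (1 - r)) * expR (a / (1 - r)).
Proof.
move=> a0 b0 /andP[r0 r1] x0 h.
have S1 n : \sum_(k < n) r ^+ k <= (1 - r)^-1.
  rewrite -[leRHS]mul1r ler_pdivlMr ?subr_gt0// -[1 - r]opprB mulrN mulrC.
  by rewrite -subrX1 opprB gerBl exprn_ge0.
have S0 n : 0 <= \sum_(k < n) r ^+ k by apply: sumr_ge0 => k _; apply: exprn_ge0.
(* Keeping the partial sums of r^k instead of their bound lets the induction close. *)
suff H n : x n <= (x 0%N + b * \sum_(k < n) r ^+ k) * expR (a * \sum_(k < n) r ^+ k).
  move=> n; apply: le_trans (H n) _; apply: ler_pM; rewrite ?expR_ge0//.
  - by rewrite addr_ge0// mulr_ge0.
  - by rewrite lerD2l ler_wpM2l.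
  - by rewrite ler_expR ler_wpM2l.
elim: n => [|n IH]; first by rewrite big_ord0 !mulr0 addr0 expR0 mulr1.
have rn : 0 <= r ^+ n by rewrite exprn_ge0.
apply: le_trans (h n) _; rewrite big_ord_recr/=.
set S := \sum_(k < n) _ in IH *; have S0' : 0 <= S := S0 n.
rewrite [b * (_ + _)]mulrDr [a * (_ + _)]mulrDr addrA mulrDl.
apply: lerD.
  rewrite expRD mulrA; apply: le_trans (_ : x n * expR (a * r ^+ n) <= _).
  - rewrite ler_wpM2l ?expR_ge1Dx//.
  - by rewrite ler_wpM2r ?expR_ge0.
rewrite -[leLHS]mulr1 ler_wpM2l ?mulr_ge0// -expR0 ler_expR.
by rewrite addr_ge0// mulr_ge0.
Qed.
End ComplexConvergence.

(** * Convergence and nonvanishing of infinite products *)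

Section InfiniteProducts.
Variable R : realType.
Implicit Types (u a : nat -> R[i]^o) (K r : R).

Lemma nc_lim_le u (l : R[i]^o) K :
  u @ \oo --> l -> (forall n, nc (u n) <= K) -> nc l <= K.
Proof.
move=> ul uK; apply/ler_addgt0Pr => e e0.
have [N _ /(_ N (leqnn N)) hN] := nc_cvgP ul e0.
have -> : l = u N - (u N - l) by rewrite subKr.
by rewrite (le_trans (ncB _ _))// lerD// ltW.
Qed.

Lemma geometric_cvg0 (u : nat -> R[i]^o) (l : R[i]) K r :
  0 <= r < 1 -> (forall n, nc (u n - l) <= K * r ^+ n) -> u @ \oo --> (l : R[i]^o).
Proof.
move=> /andP[r0 r1] h; apply: cvg_ncP => e e0.
have /cvgrPdist_lt/(_ e e0) : geometric K r @ \oo --> (0 : R).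
  by apply: cvg_geometric; rewrite ger0_norm.
apply: filterS => n /=; rewrite distrC subr0; apply: le_lt_trans.
by rewrite (le_trans (h n))// ler_norm.
Qed.

Lemma prod_1D_bound a K r : 0 <= K -> 0 <= r < 1 ->
    (forall k, nc (a k) <= K * r ^+ k) ->
  forall n, nc (\prod_(k < n) (1 + a k)) <= expR (K / (1 - r)).
Proof.
move=> K0 hr h n.
have := @geometric_growth R (fun n => nc (\prod_(k < n) (1 + a k))) K 0 r.
move=> /(_ K0 (lexx _) hr (fun n => nc_ge0 _)).
rewrite big_ord0 nc1 mul0r addr0 mul1r; apply => m.
rewrite big_ord_recr/= mul0r addr0 ncM ler_wpM2l ?nc_ge0//.
by rewrite (le_trans (ncD _ _))// nc1 lerD2l.
Qed.

Lemma prod_1D_cvg a K r : 0 <= K -> 0 <= r < 1 ->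
    (forall k, nc (a k) <= K * r ^+ k) ->
  cvgn (fun n => \prod_(k < n) (1 + a k) : R[i]^o).
Proof.
move=> K0 hr h; apply: (@geometric_cvg R _ (expR (K / (1 - r)) * K) r hr) => n.
rewrite big_ord_recr/= mulrDr mulr1 [X in nc X]addrC addrA addNr add0r ncM -mulrA.
by apply: ler_pM; rewrite ?nc_ge0//; apply: prod_1D_bound hr h _.
Qed.

(** The inverse factors are of the form 1 + b k with b again geometrically small, so their product
    converges too, and the two limits multiply to 1. *)
Lemma prod_1D_neq0 a K r (l : R[i]^o) : 0 <= K -> 0 <= r < 1 ->
    (forall k, nc (a k) <= K * r ^+ k) -> (forall k, 1 + a k != 0) ->
  (fun n => \prod_(k < n) (1 + a k) : R[i]^o) @ \oo --> l -> l != 0.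
Proof.
move=> K0 hr h a0 al; case/andP: (hr) => r0 r1.
have [N hN] : exists N, forall k, (N <= k)%N -> K * r ^+ k <= 2^-1.
  have : geometric K r @ \oo --> (0 : R).
    by apply: cvg_geometric; rewrite ger0_norm.
  move=> /cvgrPdist_lt/(_ 2^-1); rewrite invr_gt0 ltr0n => /(_ isT)[N _ hN].
  exists N => k /hN /=; rewrite distrC subr0 => /ltW; apply: le_trans.
  exact: ler_norm.
(* From N on the factors have modulus at least 1/2; the finitely many earlier ones are nonzero and
   have a positive minimum. *)
have [m m0 hm] : exists2 m : R, 0 < m & forall k, m <= nc (1 + a k).
  have [m m0 hm] : exists2 m : R, 0 < m & forall k, (k < N)%N -> m <= nc (1 + a k).
    elim: (N) => [|M [m m0 hm]]; first by exists 1.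
    exists (Num.min m (nc (1 + a M))); first by rewrite lt_min m0 nc_gt0 a0.
    move=> k; rewrite ltnS leq_eqVlt => /predU1P[->|/hm km].
      by rewrite ge_min lexx orbT.
    by rewrite ge_min km.
  exists (Num.min m 2^-1); first by rewrite lt_min m0 invr_gt0 ltr0n.
  move=> k; have [kN|Nk] := ltnP k N; first by rewrite ge_min hm.
  rewrite ge_min; apply/orP; right.
  have := ncB (1 + a k) (a k); rewrite addrK nc1.
  have := le_trans (h k) (hN k Nk); lra.
pose b k : R[i] := (1 + a k)^-1 - 1.
have /cvg_ex[/= l' bl] : cvgn (fun n => \prod_(k < n) (1 + b k) : R[i]^o).
  apply: (@prod_1D_cvg _ (K / m) r) => //; [by rewrite divr_ge0// ltW|].
  move=> k; have -> : b k = - a k / (1 + a k).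
    by rewrite /b; field.
  rewrite ncM ncV ncN mulrAC ler_pM ?nc_ge0 ?invr_ge0 ?nc_ge0//.
  by rewrite lef_pV2 ?posrE// (lt_le_trans m0).
have : (fun n => (\prod_(k < n) (1 + a k)) * (\prod_(k < n) (1 + b k)) : R[i]^o)
    @ \oo --> l * l' by exact: (cvgM al bl).
rewrite (_ : (fun _ => _) = cst 1) => [|]; last first.
  apply/funext => n /=; rewrite -big_split/= big1// => k _.
  by rewrite /b addrCA subrr addr0 divff.
move=> /cvg_unique -/(_ (@norm_hausdorff _ _) 1 (cvg_cst _)) => e.
by apply/eqP => l0; move: e; rewrite l0 mul0r => /eqP; rewrite eq_sym oner_eq0.
Qed.

End InfiniteProducts.

(** * The symbol (w; p)_oo and its differentiability *)

Section QPochhammer.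
Variables (R : realType) (p : R[i]).
Implicit Types (w x h : R[i]) (M K : nat) (B : R).
(** Inside this section [rho] is the modulus of p, not the term of the theorem. *)
Local Notation rho := (nc p).
Hypothesis p1 : rho < 1.

Definition qpart w M : R[i]^o := \prod_(j < M) (1 - w * p ^+ j).
Definition qpoch (w : R[i]) : R[i]^o := lim (qpart w @ \oo).

Let rho01 : 0 <= rho < 1. Proof. by rewrite nc_ge0. Qed.
Let rhoS : 0 <= (1 - rho)^-1. Proof. by rewrite invr_ge0 subr_ge0 ltW. Qed.

Lemma qpartS w M : qpart w M.+1 = qpart w M * (1 - w * p ^+ M).
Proof. by rewrite /qpart big_ord_recr. Qed.

Lemma qpart0 w : qpart w 0 = 1.
Proof. by rewrite /qpart big_ord0. Qed.

Lemma qpart_add w K M : qpart w (K + M) = qpart w K * qpart (w * p ^+ K) M.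
Proof.
elim: M => [|M IH]; first by rewrite addn0 qpart0 mulr1.
by rewrite addnS !qpartS IH exprD mulrA -!mulrA.
Qed.

Let qbound B := expR (B / (1 - rho)).

Lemma nc_qterm w B M : nc w <= B -> nc (1 - w * p ^+ M) <= 1 + B * rho ^+ M.
Proof.
move=> wB; rewrite (le_trans (ncB _ _))// nc1 lerD2l ncM ncX ler_wpM2r//.
by rewrite exprn_ge0// nc_ge0.
Qed.

Lemma qpart_bound w B M : nc w <= B -> nc (qpart w M) <= qbound B.
Proof.
move=> wB; rewrite /qpart.
have := @prod_1D_bound R (fun j => - (w * p ^+ j)) B rho.
apply => // [|k]; first exact: le_trans (nc_ge0 _) wB.
by rewrite ncN ncM ncX ler_wpM2r// exprn_ge0// nc_ge0.
Qed.

(** Linearity of the bound in [nc w] makes the border factors of a double product, where w is z q^M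
    or z p^M, tend to 1 geometrically. *)
Lemma qpart_sub1 w B M :
  nc w <= B -> nc (qpart w M - 1) <= nc w * (qbound B / (1 - rho)).
Proof.
move=> wB.
have := @geometric_growth R (fun n => nc (qpart w n - 1)) 0 (nc w * qbound B) rho.
move=> /(_ (lexx _) _ rho01 (fun n => nc_ge0 _)).
rewrite mulr_ge0 ?nc_ge0 ?expR_ge0// => /(_ isT).
rewrite qpart0 subrr nc0 add0r !mul0r expR0 mulr1 mulrA; apply => n.
rewrite mul0r addr0 mulr1 qpartS mulrBr mulr1 addrAC.
rewrite (le_trans (ncB _ _))// lerD2l !ncM ncX [leLHS]mulrCA [leLHS]mulrA.
rewrite ler_wpM2r ?exprn_ge0 ?nc_ge0// ler_wpM2l ?nc_ge0//.
exact: qpart_bound.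
Qed.

Lemma cvg_qpart w : qpart w @ \oo --> qpoch w.
Proof.
apply: (@prod_1D_cvg R (fun j => - (w * p ^+ j)) (nc w) rho) => // [|k].
  exact: nc_ge0.
by rewrite ncN ncM ncX.
Qed.

Lemma qpoch_split w K : qpoch w = qpart w K * qpoch (w * p ^+ K).
Proof.
apply: cvg_lim => //; rewrite -(cvg_shiftn K).
rewrite [X in X @ _](_ : _ = (fun n => qpart w K * qpart (w * p ^+ K) n)).
  2: by apply/funext => n; rewrite /= addnC qpart_add.
by apply: cvgM; [exact: cvg_cst|exact: cvg_qpart].
Qed.

Lemma qpochE w : qpoch w = (1 - w) * qpoch (w * p).
Proof. by rewrite (qpoch_split w 1) /qpart big_ord1 expr0 mulr1. Qed.

(** The derivative of [qpart w M] in w, by the product rule. *)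
Fixpoint dqpart w M : R[i]^o :=
  if M is M'.+1 then dqpart w M' * (1 - w * p ^+ M') - p ^+ M' * qpart w M'
  else 0.

Let dbound B := qbound B / (1 - rho) * qbound B.

Lemma dqpart_bound w B M : nc w <= B -> nc (dqpart w M) <= dbound B.
Proof.
move=> wB; have B0 : 0 <= B := le_trans (nc_ge0 _) wB.
have := @geometric_growth R (fun n => nc (dqpart w n)) B (qbound B) rho.
move=> /(_ B0 (expR_ge0 _) rho01 (fun n => nc_ge0 _)) /=.
rewrite nc0 add0r; apply => n.
rewrite (le_trans (ncB _ _))// lerD//.
  by rewrite ncM ler_wpM2l ?nc_ge0//; exact: nc_qterm.
by rewrite mulrC ncM ncX ler_wpM2r ?exprn_ge0 ?nc_ge0//; exact: qpart_bound.
Qed.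

Lemma cvg_dqpart w : cvgn (dqpart w).
Proof.
apply: (@geometric_cvg R _ (nc w * dbound (nc w) + qbound (nc w)) rho) => // n.
rewrite /= [X in nc X](_ : _ =
  - (dqpart w n * (w * p ^+ n) + p ^+ n * qpart w n)); last by ring.
rewrite ncN (le_trans (ncD _ _))// mulrDl lerD//.
  rewrite !ncM ncX mulrCA mulrA ler_wpM2r ?exprn_ge0 ?nc_ge0//.
  by rewrite ler_wpM2l ?nc_ge0// dqpart_bound.
by rewrite ncM ncX mulrC ler_wpM2r ?exprn_ge0 ?nc_ge0// qpart_bound.
Qed.

(** The remainder obeys E_(n+1) = E_n (1 - (w + h) p^n) - h^2 p^n [dqpart w n], so
    [geometric_growth] applies with a source term of order h^2. *)
Lemma qpart_taylor w h B M : nc w <= B -> nc (w + h) <= B ->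
  nc (qpart (w + h) M - qpart w M - h * dqpart w M)
  <= nc h ^+ 2 * (dbound B / (1 - rho) * qbound B).
Proof.
move=> wB whB; have B0 : 0 <= B := le_trans (nc_ge0 _) wB.
have d0 : 0 <= dbound B by rewrite !mulr_ge0 ?expR_ge0.
have := @geometric_growth R
  (fun n => nc (qpart (w + h) n - qpart w n - h * dqpart w n)) B
  (nc h ^+ 2 * dbound B) rho.
move=> /(_ B0 _ rho01 (fun n => nc_ge0 _)); rewrite mulr_ge0 ?exprn_ge0 ?nc_ge0//.
move=> /(_ isT); rewrite !qpart0 mulr0 !subrr nc0 add0r !mulrA; apply => n.
rewrite !qpartS /=.
set E := qpart (w + h) n - qpart w n - h * dqpart w n.
rewrite [X in nc X](_ : _ = E * (1 - (w + h) * p ^+ n)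
    - h ^+ 2 * p ^+ n * dqpart w n); last by rewrite /E; ring.
rewrite (le_trans (ncB _ _))// lerD// ncM.
  by rewrite ler_wpM2l ?nc_ge0//; exact: nc_qterm.
rewrite ncM !ncX mulrAC ler_wpM2r ?exprn_ge0 ?nc_ge0//.
have -> : nc h ^+ 2 * qbound B / (1 - rho) * qbound B = nc h ^+ 2 * dbound B.
  by rewrite /dbound !mulrA.
rewrite ler_wpM2l ?exprn_ge0 ?nc_ge0//.
exact: dqpart_bound.
Qed.

Lemma differentiable_qpoch w : differentiable (qpoch : R[i]^o -> R[i]^o) (w : R[i]^o).
Proof.
(* This B bounds both w and w + h as soon as |h| <= 1. *)
apply/derivable1_diffP; pose B := nc w + 1.
have /cvg_ex[/= D wD] := @cvg_dqpart w.
pose c := dbound B / (1 - rho) * qbound B.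
have c0 : 0 <= c by rewrite !mulr_ge0 ?expR_ge0.
have T h : nc h <= 1 -> nc (qpoch (w + h) - qpoch w - h * D) <= nc h ^+ 2 * c.
  move=> h1; have wB : nc w <= B by rewrite lerDl.
  have whB : nc (w + h) <= B by rewrite (le_trans (ncD _ _))// lerD2l.
  apply: nc_lim_le (fun M => qpart_taylor M wB whB).
  have H1 : (fun M => qpart (w + h) M - qpart w M : R[i]^o) @ \oo -->
      (qpoch (w + h) - qpoch w : R[i]^o).
    by apply: cvgB; exact: cvg_qpart.
  have H2 : (fun M => h * dqpart w M : R[i]^o) @ \oo --> (h * D : R[i]^o).
    exact: cvgM (cvg_cst _) wD.
  exact: (cvgB H1 H2).
apply/cvg_ex; exists D; apply: cvg_ncP => e e0.
have d0 : 0 < Num.min 1 (e / (c + 1)).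
  by rewrite lt_min ltr01 divr_gt0// ltr_wpDl.
near=> h.
have h0 : h != 0 by near: h; exact: nbhs_dnbhs_neq.
have hd : nc h < Num.min 1 (e / (c + 1)).
  near: h; rewrite near_withinE.
  have H : nbhs (0 : R[i]^o) [set t | nc (t - 0) < Num.min 1 (e / (c + 1))].
    exact: (@nc_cvgP R _ (nbhs (0 : R[i]^o)) _ id 0 _ cvg_id d0).
  by apply: filterS H => t /=; rewrite subr0.
move: hd; rewrite lt_min => /andP[/ltW h1 he].
rewrite [_%:A]mulr1 /= [h + w]addrC.
rewrite (_ : _ - D = h^-1 * (qpoch (w + h) - qpoch w - h * D)); last first.
  by rewrite mulrBr mulKf.
rewrite ncM ncV mulrC ltr_pdivrMr ?nc_gt0//.
apply: le_lt_trans (T h h1) _; rewrite expr2 -mulrA mulrC ltr_pM2r ?nc_gt0//.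
apply: le_lt_trans (_ : nc h * (c + 1) < e); last by rewrite -ltr_pdivlMr ?ltr_wpDl.
by rewrite ler_wpM2l ?nc_ge0// lerDl.
Unshelve. all: by end_near. Qed.

End QPochhammer.

(** * The theta function *)

Section Theta.
Variables (R : realType) (p : R[i]).
Hypothesis p1 : nc p < 1.

Definition theta (z : R[i]) : R[i]^o := qpoch p z * qpoch p (p / z).

(** The multiplier is the quotient of the first factors 1 - z^-1 and 1 - z of the symbols at z^-1
    and z. *)
Lemma thetaMp (z : R[i]) : p != 0 -> z != 0 -> theta (p * z) = - z^-1 * theta z.
Proof.
move=> p0 z0; rewrite /theta (qpochE p1 z) [p / (p * z)]mulrC invfM mulrAC mulVf// mul1r.
by rewrite (qpochE p1 z^-1) [p * z]mulrC [z^-1 * p]mulrC; field.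
Qed.

End Theta.

(** * The elliptic gamma function as a quotient of double products *)

Section EllipticGammaLimit.
Variables (R : realType).
Implicit Types (p q z : R[i]) (M : nat).

(** Square truncations of (z; p, q)_oo, matching those of [egamma], which are [dpart] at p q / z
    over [dpart] at z. *)
Definition dpart p q z M : R[i]^o :=
  \prod_(j < M) \prod_(k < M) (1 - z * p ^+ j * q ^+ k).

Definition dpoch p q z : R[i]^o := lim (dpart p q z @ \oo).

Definition regular p q z := forall j k, 1 - z * p ^+ j * q ^+ k != 0.

(** Enlarging the square adds an L-shaped border, one row and one column. The double product becomes
    a single product with factors 1 + O(r^M), within reach of the lemmas on infinite products. *)
Lemma dpartS p q z M :
  dpart p q z M.+1 =
  dpart p q z M * (qpart p (z * q ^+ M) M * qpart q (z * p ^+ M) M.+1).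
Proof.
rewrite /dpart /qpart big_ord_recr/= mulrA; congr (_ * _).
rewrite -big_split/=; apply: eq_bigr => j _.
by rewrite big_ord_recr/= mulrAC.
Qed.

Lemma dpart_neq0 p q z M : regular p q z -> dpart p q z M != 0.
Proof.
by move=> h; apply/prodf_neq0 => j _; apply/prodf_neq0 => k _; exact: h.
Qed.

(** Passing from z to z q removes the column k = 0 and adds the column k = M. *)
Lemma dpart_shift p q z M :
  dpart p q (z * q) M * qpart p z M = dpart p q z M * qpart p (z * q ^+ M) M.
Proof.
rewrite /dpart /qpart -!big_split/=; apply: eq_bigr => j _.
transitivity (\prod_(k < M.+1) (1 - z * p ^+ j * q ^+ k)).
  rewrite big_ord_recl expr0 mulr1 mulrC; congr (_ * _).
  by apply: eq_bigr => k _; rewrite /= exprS; congr (1 - _); ring.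
by rewrite big_ord_recr/=; congr (_ * _); congr (1 - _); ring.
Qed.

Section Fixed.
Variables p q : R[i].
Hypotheses (p1 : nc p < 1) (q1 : nc q < 1).

Lemma dpart_factor z : exists C, exists2 r, 0 <= C /\ 0 <= r < 1 &
  forall M, nc (qpart p (z * q ^+ M) M * qpart q (z * p ^+ M) M.+1 - 1)
            <= C * r ^+ M.
Proof.
have small (s : R[i]) M : nc s < 1 -> nc (z * s ^+ M) <= nc z.
  by move=> s1; rewrite ncM ncX ler_piMr ?nc_ge0// exprn_ile1 ?nc_ge0// ltW.
pose b (s : R[i]) := expR (nc z / (1 - nc s)).
have b0 s : 0 <= b s := expR_ge0 _.
pose c (s : R[i]) := nc z * (b s / (1 - nc s)).
have c0 s : nc s < 1 -> 0 <= c s.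
  by move=> s1; rewrite !mulr_ge0 ?nc_ge0// invr_ge0 subr_ge0 ltW.
pose r := Num.max (nc p) (nc q).
have r01 : 0 <= r < 1 by rewrite le_max nc_ge0 gt_max p1 q1.
have [rp rq] : nc p <= r /\ nc q <= r by rewrite !le_max !lexx orbT.
exists (c p * b q + c q), r => [|M].
  by split=> //; apply: addr_ge0; [apply: mulr_ge0; [exact: c0|exact: b0]|exact: c0].
set A := qpart p _ _; set B := qpart q _ _.
have hA : nc (A - 1) <= c p * r ^+ M.
  apply: le_trans (qpart_sub1 p1 M (small q M q1)) _.
  rewrite ncM mulrAC ler_wpM2l ?c0// ncX lerXn2r ?nnegrE ?nc_ge0//.
  by rewrite le_max nc_ge0.
have hB : nc (B - 1) <= c q * r ^+ M.
  apply: le_trans (qpart_sub1 q1 M.+1 (small p M p1)) _.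
  rewrite ncM mulrAC ler_wpM2l ?c0// ncX lerXn2r ?nnegrE ?nc_ge0//.
  by rewrite le_max nc_ge0.
have hB' : nc B <= b q := qpart_bound q1 M.+1 (small p M p1).
rewrite (_ : A * B - 1 = (A - 1) * B + (B - 1)); last by ring.
rewrite (le_trans (ncD _ _))// [leRHS]mulrDl lerD// ncM [leRHS]mulrAC.
by apply: ler_pM; rewrite ?nc_ge0.
Qed.

Lemma dpart_prod z M : dpart p q z M =
  \prod_(l < M) (1 + (qpart p (z * q ^+ l) l * qpart q (z * p ^+ l) l.+1 - 1)).
Proof.
elim: M => [|M IH]; first by rewrite /dpart !big_ord0.
by rewrite dpartS IH [RHS]big_ord_recr/= [1 + _]addrC subrK.
Qed.

Lemma cvg_dpart z : dpart p q z @ \oo --> dpoch p q z.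
Proof.
have [C [r [C0 r01] h]] := dpart_factor z.
have := @prod_1D_cvg R _ C r C0 r01 h.
by rewrite (_ : (fun _ => _) = dpart p q z)//; apply/funext => M; rewrite dpart_prod.
Qed.

Lemma dpoch_neq0 z : regular p q z -> dpoch p q z != 0.
Proof.
move=> zr; have [C [r [C0 r01] h]] := dpart_factor z.
apply: (@prod_1D_neq0 R _ C r _ C0 r01 h) => [M|].
  rewrite [1 + _]addrC subrK; have := dpart_neq0 M.+1 zr.
  by rewrite dpartS mulf_eq0 negb_or => /andP[].
have := @cvg_dpart z.
by under eq_cvg do rewrite dpart_prod.
Qed.

(** The limit of [dpart_shift]: the added column tends to 1 by [qpart_sub1]. *)
Lemma dpoch_shift z : dpoch p q (z * q) * qpoch p z = dpoch p q z.
Proof.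
have H1 : (fun M => dpart p q (z * q) M * qpart p z M : R[i]^o) @ \oo -->
    (dpoch p q (z * q) * qpoch p z : R[i]^o).
  by apply: cvgM; [exact: cvg_dpart|exact: cvg_qpart].
have H2 : (fun M => dpart p q z M * qpart p (z * q ^+ M) M : R[i]^o) @ \oo -->
    (dpoch p q z * 1 : R[i]^o).
  apply: cvgM; first exact: cvg_dpart.
  pose c := nc z * (expR (nc z / (1 - nc p)) / (1 - nc p)).
  apply: (@geometric_cvg0 R _ _ c (nc q)) => [|M]; first by rewrite nc_ge0.
  have zq : nc (z * q ^+ M) <= nc z.
    by rewrite ncM ncX ler_piMr ?nc_ge0// exprn_ile1 ?nc_ge0// ltW.
  by rewrite (le_trans (qpart_sub1 p1 M zq))// ncM ncX mulrAC.
move: H1; rewrite (_ : (fun _ => _) =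
  (fun M => dpart p q z M * qpart p (z * q ^+ M) M)) => [H1|]; last first.
  by apply/funext => M; exact: dpart_shift.
by rewrite -[RHS]mulr1; apply: cvg_unique H1 H2; exact: norm_hausdorff.
Qed.

Lemma egammaE z : dpoch p q z != 0 ->
  egamma p q z = dpoch p q (p * q / z) / dpoch p q z.
Proof.
move=> z0; rewrite /egamma; apply: (@cvg_lim R[i]^o); first exact: norm_hausdorff.
rewrite (_ : (fun _ => _) = fun M => dpart p q (p * q / z) M / dpart p q z M).
  by apply: cvgM; [exact: cvg_dpart|apply: cvgV => //; exact: cvg_dpart].
apply/funext => M; rewrite /dpart -prodf_div; apply: eq_bigr => j _.
rewrite -prodf_div; apply: eq_bigr => k _; congr ((1 - _) / _).
by rewrite !exprS; ring.
Qed.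

Lemma egamma_neq0 z : regular p q z -> regular p q (p * q / z) -> egamma p q z != 0.
Proof.
by move=> h h'; rewrite egammaE ?dpoch_neq0// mulf_neq0 ?invr_eq0 ?dpoch_neq0.
Qed.

(** The numerator gains [qpoch p (p / z)] and the denominator loses [qpoch p z]; together these form
    theta. *)
Lemma egamma_shift z : q != 0 -> z != 0 -> regular p q z ->
  egamma p q (q * z) = theta p z * egamma p q z.
Proof.
move=> q0 z0 zr; have d0 := dpoch_neq0 zr; have := d0.
rewrite -dpoch_shift mulf_eq0 negb_or => /andP[zq0 fz0].
rewrite mulrC !egammaE// -[in RHS](dpoch_shift z) /theta.
have -> : p * q / (z * q) = p / z by field; rewrite z0 q0.
rewrite -(dpoch_shift (p / z)) [p / z * q]mulrAC.
by field; rewrite zq0 fz0.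
Qed.

Lemma theta_neq0 z : regular p q z -> regular p q (p / z) -> theta p z != 0.
Proof.
move=> /dpoch_neq0; rewrite -dpoch_shift mulf_eq0 negb_or => /andP[_ fz0].
move/dpoch_neq0; rewrite -dpoch_shift mulf_eq0 negb_or => /andP[_ fz1].
exact: mulf_neq0.
Qed.

End Fixed.
End EllipticGammaLimit.

(** * Generic properties and generically meromorphic functions *)

Section Generic.
Variables (R : realType) (V : normedModType R[i]).
Implicit Types (D U : set V) (f g h : V -> R[i]^o) (P Q : V -> Prop).

Lemma near_neq0 g v : differentiable g v -> g v != 0 -> nbhs v [set w | g w != 0].
Proof.
move=> /differentiable_continuous gc gv0.
have := @cvgr_neq0 _ _ _ (nbhs v) _ g (g v) gc gv0.
exact.
Qed.

Lemma holomorphicM U U' g h : holomorphic_on U g -> holomorphic_on U' h ->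
  holomorphic_on (U `&` U') (fun v => g v * h v).
Proof.
move=> [oU dg] [oU' dh]; split; first exact: openI.
by move=> u [Uu U'u]; apply: differentiableM; [exact: dg|exact: dh].
Qed.

Lemma holomorphic_sub U U' g : open U' -> U' `<=` U ->
  holomorphic_on U g -> holomorphic_on U' g.
Proof. by move=> oU' UU' [oU dg]; split=> // u /UU'; exact: dg. Qed.

Lemma nondegenerate_sub U U' g : open U' -> U' `<=` U ->
  nondegenerate_on U g -> nondegenerate_on U' g.
Proof.
move=> oU' UU' [hg Ug]; split; first exact: holomorphic_sub hg.
by move=> u /UU'; exact: Ug.
Qed.

(** A point where g is nonzero has an open neighbourhood where g stays nonzero, and the nonzero
    points of h are dense there. *)
Lemma nondegenerateM U U' g h : nondegenerate_on U g -> nondegenerate_on U' h ->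
  nondegenerate_on (U `&` U') (fun v => g v * h v).
Proof.
move=> [hg Ug] [hh Uh]; split; first exact: holomorphicM.
case: hg hh => [oU dg] [oU' dh] u [Uu U'u] B.
rewrite nbhsE => -[W [oW Wu] WB].
have : nbhs u (W `&` (U `&` U')).
  by apply: open_nbhs_nbhs; split=> //; do ?apply: openI.
move=> /(Ug _ Uu)[v [/= gv0 [Wv [Uv U'v]]]].
have : nbhs v (W `&` [set w | g w != 0]).
  apply: filterI; first exact: open_nbhs_nbhs.
  by apply: near_neq0 => //; exact: dg.
move=> /(Uh _ U'v)[w [/= hw0 [Ww gw0]]].
by exists w; split; [rewrite /= mulf_neq0|exact: WB].
Qed.

Lemma nondegenerate1 U : open U -> nondegenerate_on U (cst 1).
Proof.
move=> oU; split; first by split.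
by move=> u _; apply: subset_closure; rewrite /= oner_neq0.
Qed.

Lemma generic_sub D P Q : (forall u, P u -> Q u) ->
  generically D P -> generically D Q.
Proof.
move=> PQ hP u /hP[U [g [Uu gU gP]]]; exists U, g; split=> // v Uv gv.
exact/PQ/gP.
Qed.

Lemma generic_and D P Q : generically D P -> generically D Q ->
  generically D (fun u => P u /\ Q u).
Proof.
move=> hP hQ u Du; have [U [g [Uu gU gP]]] := hP u Du.
have [U' [h [U'u hU hQ']]] := hQ u Du.
exists (U `&` U'), (fun v => g v * h v); split; first by split.
  exact: nondegenerateM.
by move=> v [Uv U'v]; rewrite mulf_eq0 negb_or => /andP[g0 h0]; split; [apply: gP|apply: hQ'].
Qed.

Lemma genericT D P : open D -> (forall u, D u -> P u) -> generically D P.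
Proof.
by move=> oD DP u Du; exists D, (cst 1); split=> // [|v Dv _];
  [exact: nondegenerate1|exact: DP].
Qed.

Lemma generic_all (I : eqType) (s : seq I) D (P : I -> V -> Prop) : open D ->
  (forall i, i \in s -> generically D (P i)) ->
  generically D (fun u => forall i, i \in s -> P i u).
Proof.
move=> oD; elim: s => [|i s IH] h; first exact: genericT.
have h1 := h i (mem_head _ _).
have h2 : generically D (fun u => forall j, j \in s -> P j u).
  by apply: IH => j js; apply: h; rewrite in_cons js orbT.
apply: generic_sub (generic_and h1 h2) => u [Pi Ps] j.
by rewrite in_cons => /predU1P[->//|]; exact: Ps.
Qed.

(** Since Q may depend on the point, an infinite conjunction can be replaced near each point by the
    finite part that matters there. *)
Lemma generic_local D P :
  (forall u, D u -> exists W Q,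
     [/\ nbhs u W, generically D Q & forall v, W v -> Q v -> P v]) ->
  generically D P.
Proof.
move=> h u Du; have [W [Q [uW hQ WQ]]] := h u Du.
have [U [g [Uu gU gQ]]] := hQ u Du.
have oU : open U by case: gU => -[].
have UW : nbhs u (U `&` W) by apply: filterI => //; exact: open_nbhs_nbhs.
exists (U `&` W)^°, g; split.
- exact: nbhs_singleton (nbhs_interior UW).
- apply: nondegenerate_sub gU; first exact: open_interior.
  by move=> v /interior_subset[].
- by move=> v /interior_subset[Uv Wv] gv; apply: WQ => //; exact: gQ.
Qed.

Lemma nondegenerateP D g : holomorphic_on D g -> generically D (fun u => g u != 0) ->
  nondegenerate_on D g.
Proof.
move=> hg h; split=> // u Du B uB; have [U [k [Uu [[oU dk] kU] kg]]] := h u Du.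
have : nbhs u (B `&` U) by apply: filterI => //; exact: open_nbhs_nbhs.
move=> /(kU _ Uu)[v [/= kv [Bv Uv]]]; exists v; split=> //=.
exact: kg.
Qed.

Lemma generic_neq0 D g : nondegenerate_on D g -> generically D (fun u => g u != 0).
Proof. by move=> gD u Du; exists D, g; split. Qed.

(** Unlike in [meromorphic_on], numerator and denominator play symmetric roles, and f is left free
    at the zeros of g as well; inversion is then an exchange of g and h. *)
Definition merogeneric D f : Prop :=
  forall u, D u -> exists U g h, [/\ U u, nondegenerate_on U g, nondegenerate_on U h
    & forall v, U v -> g v != 0 -> h v != 0 -> f v = g v / h v].

Lemma merogeneric_nondegenerate D g : nondegenerate_on D g -> merogeneric D g.
Proof.
move=> gD u Du; have oD : open D by case: gD => -[].
exists D, g, (cst 1); split=> //; first exact: nondegenerate1.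
by move=> v _ _ _; rewrite /= divr1.
Qed.

Lemma merogeneric1 D : open D -> merogeneric D (cst 1).
Proof. by move=> oD; apply: merogeneric_nondegenerate; exact: nondegenerate1. Qed.

Lemma merogeneric_ext D f f' : open D -> (forall u, D u -> f u = f' u) ->
  merogeneric D f' -> merogeneric D f.
Proof.
move=> oD ff' hf u Du; have [U [g [h [Uu gU hU fE]]]] := hf u Du.
have oU : open U by case: gU => -[].
exists (U `&` D), g, h; split=> //.
- by apply: nondegenerate_sub gU => [|v []//]; exact: openI.
- by apply: nondegenerate_sub hU => [|v []//]; exact: openI.
- by move=> v [Uv Dv] g0 h0; rewrite ff'// fE.
Qed.

Lemma merogenericV D f : merogeneric D f -> merogeneric D (fun v => (f v)^-1).
Proof.
move=> hf u /hf[U [g [h [Uu gU hU fE]]]]; exists U, h, g; split=> // v Uv h0 g0.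
by rewrite fE// invf_div.
Qed.

Lemma merogenericM D f g : merogeneric D f -> merogeneric D g ->
  merogeneric D (fun v => f v * g v).
Proof.
move=> hf hg u Du; have [U [a [b [Uu aU bU fE]]]] := hf u Du.
have [U' [c [d [U'u cU dU gE]]]] := hg u Du.
exists (U `&` U'), (fun v => a v * c v), (fun v => b v * d v).
split; [by split|exact: nondegenerateM|exact: nondegenerateM|].
move=> v [Uv U'v]; rewrite !mulf_eq0 !negb_or => /andP[a0 c0] /andP[b0 d0].
by rewrite fE// gE// mulf_div.
Qed.

Lemma merogeneric_prod (I : Type) (s : seq I) D (f : I -> V -> R[i]^o) : open D ->
  (forall i, merogeneric D (f i)) -> merogeneric D (fun v => \prod_(i <- s) f i v).
Proof.
move=> oD h; elim: s => [|i s IH].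
  rewrite (_ : (fun _ => _) = cst 1); first exact: merogeneric1.
  by apply/funext => v; rewrite big_nil.
rewrite (_ : (fun _ => _) = fun v => f i v * \prod_(j <- s) f j v).
  exact: merogenericM.
by apply/funext => v; rewrite big_cons.
Qed.

(** Multiplying g and h by g k moves the zeros of g and the exceptional set of the generic equality
    into the zeros of the denominator, where values are ignored. *)
Lemma merogeneric_meromorphic D f f' : merogeneric D f' ->
  generically D (fun u => f u = f' u) -> meromorphic_on D f.
Proof.
move=> hf' hE u Du; have [U [g [h [Uu gU hU fE]]]] := hf' u Du.
have [U' [k [U'u kU kE]]] := hE u Du.
have nk := nondegenerateM gU kU.
exists (U `&` (U `&` U')), (fun v => g v * (g v * k v)), (fun v => h v * (g v * k v)).
split.
- by split.
- by apply: holomorphicM; [case: gU|case: nk].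
- exact: nondegenerateM.
move=> v [Uv [_ U'v]]; rewrite !mulf_eq0 !negb_or => /andP[h0 /andP[g0 k0]].
by rewrite kE// fE// -mulf_div divff ?mulr1// mulf_neq0.
Qed.

End Generic.

(** * Differentiability of powers and products *)

Section DifferentiableAt.
Variables (R : realType) (V : normedModType R[i]).

(* Fixes the normed module structure, which is not inferred from the
   carrier when the latter is a product. *)
Definition differentiable_at (f : V -> R[i]^o) (x : V) : Prop :=
  differentiable f x.

Lemma differentiable_exprz (f : V -> R[i]^o) (n : int) x :
  differentiable_at f x -> f x != 0 -> differentiable_at (fun v => f v ^ n : R[i]^o) x.
Proof.
move=> df f0.
have H k : differentiable_at (fun v => f v ^+ k : R[i]^o) x.
  elim: k => [|k IH]; first exact: differentiable_cst.
  rewrite (_ : (fun _ => _) = fun v => f v * f v ^+ k); first exact: differentiableM.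
  by apply/funext => v; rewrite exprS.
case: n => k; first exact: H.
by apply: differentiableV; [exact: H|rewrite expf_neq0].
Qed.

Lemma differentiable_prod (I : Type) (s : seq I)
    (f : I -> V -> R[i]^o) x :
  (forall i, differentiable_at (f i) x) ->
  differentiable_at (fun v => \prod_(i <- s) f i v : R[i]^o) x.
Proof.
move=> h; elim: s => [|i s IH].
  rewrite (_ : (fun _ => _) = cst 1); first exact: differentiable_cst.
  by apply/funext => v; rewrite big_nil.
rewrite (_ : (fun _ => _) = fun v => f i v * \prod_(j <- s) f j v).
  by apply: differentiableM; [exact: h|exact: IH].
by apply/funext => v; rewrite big_cons.
Qed.

Lemma near_nc_lt (g : V -> R[i]^o) (x : V) (B : R) :
  differentiable_at g x -> nc (g x) < B -> nbhs x [set y | nc (g y) < B].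
Proof.
move=> /differentiable_continuous gc gB; have e0 : 0 < B - nc (g x) by rewrite subr_gt0.
have H : nbhs x [set y | nc (g y - g x) < B - nc (g x)].
  exact: (@nc_cvgP R _ (nbhs x) _ g (g x) _ gc e0).
apply: filterS H => y /=; rewrite ltrBrDr; apply: le_lt_trans.
by rewrite -{1}(subrK (g x) (g y)) ncD.
Qed.

(** When w is the part of x in one coordinate, this path rescales that coordinate by s. *)
Lemma cvg_line (x w : V) : x + (s - 1) *: w @[s --> (1 : R[i]^o)] --> x.
Proof.
have h : (s - 1 : R[i]^o) @[s --> (1 : R[i]^o)] --> (1 - 1 : R[i]^o).
  have hi : id @ nbhs (1 : R[i]^o) --> (1 : R[i]^o) by exact: cvg_id.
  have hc : (fun=> 1 : R[i]^o) @ nbhs (1 : R[i]^o) --> (1 : R[i]^o).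
    exact: cvg_cst.
  exact: (cvgB hi hc).
have h2 : x + (s - 1) *: w @[s --> (1 : R[i]^o)] --> x + (1 - 1) *: w.
  have h0 : (fun=> x) @ nbhs (1 : R[i]^o) --> x by exact: cvg_cst.
  have h1 : (s - 1) *: w @[s --> (1 : R[i]^o)] --> (1 - 1) *: w.
    exact: (@cvgZr_tmp _ _ _ _ _ _ _ w h).
  exact: (cvgD h0 h1).
by rewrite subrr scale0r addr0 in h2.
Qed.

End DifferentiableAt.

(** * Laurent monomials on the domain *)

Section Monomials.
Variables (R : realType) (N : nat).
Local Notation point := ('rV[R[i]]_N * R[i]^o)%type.
Local Notation D := (@term_domain R N).
Local Notation exponent := ('rV[int]_N * int)%type.
Implicit Types (u : point) (d : exponent) (b : 'I_N) (c s : R[i]).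

Definition mono d u : R[i]^o := (\prod_b (u.1 0 b) ^ (d.1 0 b)) * u.2 ^ d.2.

Lemma domainP u : D u <-> [/\ forall b, u.1 0 b != 0, u.2 != 0 & nc u.2 < 1].
Proof.
rewrite /term_domain /= normr_gt0 ncE (_ : 1 = 1%:C) ?ltcR//.
by split=> [[h /andP[]]|[h h1 h2]]; split=> //; apply/andP.
Qed.

Lemma mono_neq0 d u : D u -> mono d u != 0.
Proof.
move=> /domainP[u0 q0 _]; rewrite mulf_neq0// ?expfz_neq0//.
by apply/prodf_neq0 => b _; rewrite expfz_neq0.
Qed.

Lemma monoD d d' u : D u -> mono (d + d') u = mono d u * mono d' u.
Proof.
move=> /domainP[u0 q0 _]; rewrite /mono /= expfzDr// mulrACA -big_split/=.
by congr (_ * _); apply: eq_bigr => b _; rewrite mxE expfzDr.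
Qed.

Lemma monoN d u : mono (- d) u = (mono d u)^-1.
Proof.
rewrite /mono /= invfM -invr_expz; congr (_ * _).
by rewrite -prodfV; apply: eq_bigr => b _; rewrite mxE invr_expz.
Qed.

Lemma mono_scale d b s u : s != 0 -> D u ->
  mono d (scale_var b s u.1, u.2) = s ^ (d.1 0 b) * mono d u.
Proof.
move=> s0 /domainP[u0 q0 _]; rewrite /mono /= mulrA; congr (_ * _).
rewrite (bigD1 b)//= [in RHS](bigD1 b)//= mxE eqxx expfzMl -mulrA.
by congr (_ * (_ * _)); apply: eq_bigr => i ib; rewrite mxE (negbTE ib).
Qed.

Lemma mono_scaleq d s u : mono d (u.1, s * u.2) = s ^ d.2 * mono d u.
Proof. by rewrite /mono /= expfzMl mulrCA. Qed.

Lemma monoq (n : int) u : mono (0, n) u = u.2 ^ n.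
Proof. by rewrite /mono /= big1 ?mul1r// => b _; rewrite mxE expr0z. Qed.

Lemma differentiable_fst1 b u : differentiable_at (fun v : point => v.1 0 b : R[i]^o) u.
Proof.
(* Packaged as a linear map, the coordinate is differentiable as soon as it is continuous. *)
have @f : {linear point -> R[i]^o}.
  by exists (fun v : point => v.1 0 b); do 2![eexists]; do ?[constructor];
     rewrite ?mxE// => ? *; rewrite ?mxE//; move=> ?; rewrite !mxE.
rewrite (_ : (fun _ => _) = f)//; apply/linear_differentiable => v.
have h1 : fst @ v --> v.1 by exact: cvg_fst.
exact: (continuous_cvg _ (@coord_continuous R[i] 1 N 0 b v.1) h1).
Qed.

Lemma differentiable_snd u : differentiable_at (fun v : point => v.2 : R[i]^o) u.
Proof.
have @f : {linear point -> R[i]^o}.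
  by exists (fun v : point => v.2); do 2![eexists]; do ?[constructor].
rewrite (_ : (fun _ => _) = f)//; apply/linear_differentiable => v.
exact: cvg_snd.
Qed.

Lemma open_domain : @open (point : normedModType R[i]) D.
Proof.
rewrite openE => u /domainP[u0 q0 q1].
have H1 : nbhs (u : (point : normedModType R[i])) [set v : point | forall b, v.1 0 b != 0].
  exact: (@filter_forall _ _ (fun b => [set v : point | v.1 0 b != 0]) _
    (nbhs_filter (u : (point : normedModType R[i])))
    (fun b => near_neq0 (differentiable_fst1 b u) (u0 b))).
have H2 := near_neq0 (differentiable_snd u) q0.
have H3 := near_nc_lt (differentiable_snd u) q1.
apply: filterS3 H1 H2 H3 => v /= h1 h2 h3; exact/domainP.
Qed.

Lemma differentiable_mono d u : D u -> differentiable_at (mono d) u.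
Proof.
move=> /domainP[u0 q0 _]; apply: differentiableM.
  apply: differentiable_prod => b; apply: differentiable_exprz => //.
  exact: differentiable_fst1.
by apply: differentiable_exprz => //; exact: differentiable_snd.
Qed.

Lemma holomorphic_mono d c : holomorphic_on D (fun u => c * mono d u).
Proof.
split=> [|u Du]; first exact: open_domain.
by apply: differentiableM; [exact: differentiable_cst|exact: differentiable_mono].
Qed.

(** At a zero, rescaling a coordinate of nonzero exponent by a real t slightly above 1 multiplies
    the monomial by a nontrivial power of t. The condition bears on [d.1] alone and so survives
    multiplication by powers of q. *)
Lemma nondegenerate_1Bmono d c : d.1 != 0 ->
  nondegenerate_on D (fun u => 1 - c * mono d u).
Proof.
move=> d0; have hol : holomorphic_on D (fun u => 1 - c * mono d u).
  have [oD h] := holomorphic_mono d c; split; first exact: oD.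
  move=> u Du.
  by apply: differentiableB; [exact: differentiable_cst|exact: h].
split; first exact: hol.
move=> u Du B uB; have [e1|h] := pselect (1 - c * mono d u = 0); last first.
  exists u; split; last exact: nbhs_singleton.
  exact/eqP.
have [b db] : exists b, d.1 0 b != 0.
  apply/existsP; apply: contraNT d0; rewrite negb_exists => /forallP h.
  by apply/eqP/rowP => b; rewrite mxE; apply/eqP; have := h b; rewrite negbK.
pose w : point := (\row_j (if j == b then u.1 0 j else 0), 0).
have phiE (s : R[i]) : u + (s - 1) *: w = (scale_var b s u.1, u.2).
  congr pair; last by rewrite /= scaler0 addr0.
  apply/rowP => j; rewrite !mxE; case: eqP => _; last by rewrite mulr0 addr0.
  by rewrite mulrBl mul1r addrC subrK.
have := @cvg_line R (point : normedModType R[i]) u w.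
move=> /(_ B uB) /nbhs_ballP[e /= e0 he].
have e0' : 0 < complex.Re e by move: e0; rewrite ltcE /= => /andP[].
have eR : e = (complex.Re e)%:C by rewrite RRe_real// ger0_real// ltW.
(* Half the radius keeps t in the ball around 1; for a real t > 1 an integer power equals 1 only if
   its exponent is 0. *)
pose t : R := 1 + complex.Re e / 2.
have t0 : 0 < t by rewrite addr_gt0// divr_gt0.
exists (scale_var b t%:C u.1, u.2); split => /=.
  have t0C : t%:C != 0 :> R[i] by rewrite -(rmorph0 (real_complex R)) (inj_eq (@complexI R)) gt_eqF.
  rewrite mono_scale// mulrCA.
  have -> : c * mono d u = 1 by apply/eqP; rewrite eq_sym -subr_eq0 e1.
  rewrite mulr1 subr_eq0 eq_sym -fmorphXz -(rmorph1 (real_complex R)).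
  rewrite (inj_eq (@complexI R)) pexprz_eq1 ?ltW// negb_or db.
  by rewrite /t -subr_eq0 addrAC subrr add0r mulf_neq0 ?gt_eqF// invr_gt0.
rewrite -phiE; apply: he; rewrite /ball /= /t rmorphD rmorph1 opprD addrA subrr add0r.
rewrite ncE ncN nc_real; last by rewrite divr_ge0// ltW.
by rewrite eR /= ltcR ltr_pdivrMr// ltr_pMr// ltr1n.
Qed.

End Monomials.

(** * Generic regularity of monomials and theta quotients *)

Section RegularMonomials.
Variables (R : realType) (N : nat) (p : R[i]).
Local Notation point := ('rV[R[i]]_N * R[i]^o)%type.
Local Notation D := (@term_domain R N).
Local Notation exponent := ('rV[int]_N * int)%type.
Implicit Types (u : point) (d : exponent) (b : 'I_N) (c s : R[i]).
Hypotheses (p1 : nc p < 1) (p0 : p != 0).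

Lemma one_sub_neq0 (z : R[i]) : nc z < 1 -> 1 - z != 0.
Proof.
by apply: contraTneq => /eqP; rewrite subr_eq0 => /eqP <-; rewrite nc1 ltxx.
Qed.

(** Near u only the factors with j, k < K can vanish, as the others subtract from 1 a term of
    modulus less than 1; each of the remaining finitely many conditions is generic. The base s q
    covers both q and p q. *)
Lemma generic_regular s c d : s != 0 -> nc s <= 1 -> c != 0 -> d.1 != 0 ->
  generically D (fun u => regular p (s * u.2) (c * mono d u)).
Proof.
move=> s0 s1 c0 d0; apply: generic_local => u Du.
have [_ _ q1] := (domainP u).1 Du.
(* B and r bound the monomial and the base near u, as r lies strictly between |q| and 1. *)
pose B := nc (c * mono d u) + 1; pose r := (1 + nc u.2) / 2.
have r1 : r < 1 by rewrite /r; lra.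
have r0 : 0 <= r by rewrite divr_ge0// addr_ge0// nc_ge0.
pose m := Num.max (nc p) r.
have [K hK] : exists K, B * m ^+ K < 1.
  have : geometric B m @ \oo --> (0 : R).
    by apply: cvg_geometric; rewrite ger0_norm ?gt_max ?p1// le_max r0 orbT.
  move=> /cvgrPdist_lt/(_ 1 ltr01)[K _ /(_ K (leqnn K))].
  rewrite /= distrC subr0 => hK; exists K.
  exact: le_lt_trans (ler_norm _) hK.
have hol := holomorphic_mono d c.
exists ([set v : point | nc (c * mono d v) < B] `&` [set v : point | nc v.2 < r]).
exists (fun v => D v /\ forall jk, jk \in [seq (j, k) | j <- iota 0 K, k <- iota 0 K] ->
  1 - (c * p ^+ jk.1 * s ^+ jk.2) * mono (d + (0, jk.2%:Z)) v != 0).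
split.
- apply: filterI.
    by apply: near_nc_lt; [case: hol => _; exact|rewrite ltrDl].
  apply: near_nc_lt; first exact: differentiable_snd.
  by rewrite /r; lra.
- apply: generic_and; first by apply: genericT => //; exact: open_domain.
  apply: generic_all => [|jk _]; first exact: open_domain.
  apply: generic_neq0; apply: nondegenerate_1Bmono.
  by rewrite /= addr0.
move=> v [/= Bv rv] [Dv hv] j k.
have [_ v0 v1] := (domainP v).1 Dv.
have [/andP[jK kK]|] := boolP ((j < K) && (k < K))%N.
  have /hv : (j, k) \in [seq (j, k) | j <- iota 0 K, k <- iota 0 K].
    by apply/allpairsP; exists (j, k); rewrite !mem_iota.
  rewrite /= monoD// monoq -exprnP exprMn; congr (1 - _ != 0); ring.
rewrite negb_and -!leqNgt => jkK; apply: one_sub_neq0.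
have m0 : 0 <= m by rewrite le_max nc_ge0.
have m1 : m <= 1 by rewrite ge_max !ltW.
have qm : nc (s * v.2) <= m.
  rewrite le_max; apply/orP; right; rewrite ncM; apply: le_trans (ltW rv).
  by rewrite ler_piMl// nc_ge0.
have pm : nc p <= m by rewrite le_max lexx.
move: (c * mono d v) (s * v.2) Bv qm => z q' Bv qm.
apply: le_lt_trans hK; rewrite !ncM !ncX -mulrA.
apply: ler_pM; [exact: nc_ge0|by rewrite mulr_ge0 ?exprn_ge0 ?nc_ge0|exact: ltW|].
apply: le_trans (_ : m ^+ (j + k) <= _); last first.
  apply: ler_wiXn2l => //; case/orP: jkK => h; first exact: leq_trans h (leq_addr _ _).
  exact: leq_trans h (leq_addl _ _).
by rewrite exprD; apply: ler_pM; rewrite ?exprn_ge0 ?nc_ge0 ?lerXn2r ?nnegrE ?nc_ge0.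
Qed.

(** The two conditions keep z off the poles and off the zeros of Gamma. *)
Definition regular2 q z := regular p q z /\ regular p q (p * q / z).

Lemma generic_regular2 s c d : s != 0 -> nc s <= 1 -> c != 0 -> d.1 != 0 ->
  generically D (fun u => regular2 (s * u.2) (c * mono d u)).
Proof.
move=> s0 s1 c0 d0; apply: generic_sub (_ : forall u,
  D u /\ (regular p (s * u.2) (c * mono d u) /\
    regular p (s * u.2) ((p * s / c) * mono (- d + (0, 1)) u)) -> _) _.
  move=> u [Du [h1 h2]]; split=> //; move: h2.
  have e (a b q m : R[i]) : a * b / c * (m^-1 * q) = a * (b * q) / (c * m).
    by rewrite invfM; ring.
  by rewrite monoD// monoN monoq expr1z e.
apply: generic_and; first by apply: genericT => //; exact: open_domain.
apply: generic_and; first exact: generic_regular.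
apply: generic_regular => //; first by rewrite !mulf_neq0 ?invr_eq0.
by rewrite /= addr0 oppr_eq0.
Qed.

Lemma nondegenerate_theta c d : c != 0 -> d.1 != 0 ->
  nondegenerate_on D (fun u => theta p (c * mono d u)).
Proof.
move=> c0 d0; apply: nondegenerateP.
  split=> [|u Du]; first exact: open_domain.
  have [_ h1] := holomorphic_mono d c.
  have dq w := differentiable_qpoch p1 w.
  have h2 : differentiable_at (fun u => p / (c * mono d u)) u.
    apply: differentiableM; first exact: differentiable_cst.
    by apply: differentiableV; [exact: h1|rewrite mulf_neq0 ?mono_neq0].
  apply: differentiableM.
    exact: (differentiable_comp (h1 u Du) (dq _)).
  exact: (differentiable_comp h2 (dq _)).
apply: generic_sub (_ : forall u,
  D u /\ (regular p (1 * u.2) (c * mono d u) /\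
    regular p (1 * u.2) ((p / c) * mono (- d) u)) -> _) _.
  move=> u [Du [+ h2]]; have [_ q0 q1] := (domainP u).1 Du.
  rewrite mul1r => h1; apply: (theta_neq0 p1 q1) => //.
  have e (a m : R[i]) : a / (c * m) = a / c * m^-1 by rewrite invfM mulrA.
  by rewrite e -monoN; move: h2; rewrite mul1r.
apply: generic_and; first by apply: genericT => //; exact: open_domain.
by apply: generic_and; apply: generic_regular; rewrite ?nc1 ?oner_neq0 ?mulf_neq0 ?invr_eq0 ?oppr_eq0.
Qed.

(** The quotient Gamma(q^s z) / Gamma(z) for s of either sign; [Negz n] is -(n + 1), which explains
    the n.+1 inverse factors. *)
Definition thetaz (q z : R[i]) (s : int) : R[i]^o :=
  match s with
  | Posz n => \prod_(l < n) theta p (z * q ^ (l : int))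
  | Negz n => (\prod_(l < n.+1) theta p (z * q ^ (Negz l)))^-1
  end.

Lemma egamma_shiftz q z (s : int) : q != 0 -> nc q < 1 -> z != 0 ->
  (forall k : nat, (k <= `|s|)%N ->
     regular2 q (q ^ (k : int) * z) /\ regular2 q (q ^ (- (k : int)) * z)) ->
  egamma p q (q ^ s * z) = thetaz q z s * egamma p q z.
Proof.
move=> q0 q1 z0; case: s => [] n h.
  suff H m : (m <= n)%N -> egamma p q (q ^ (m : int) * z)
      = (\prod_(l < m) theta p (z * q ^ (l : int))) * egamma p q z by rewrite H.
  elim: m => [|m IH] mn; first by rewrite expr0z mul1r big_ord0 mul1r.
  rewrite big_ord_recr/= mulrAC -IH ?(ltnW mn)// [RHS]mulrC.
  have -> : q ^ (m.+1 : int) * z = q * (q ^ (m : int) * z).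
    by rewrite -!exprnP exprS mulrA.
  rewrite egamma_shift//.
  - by rewrite [z * _]mulrC.
  - by rewrite mulf_neq0 ?expfz_neq0.
  by have [[+ _] _] := h m (ltnW mn).
have {h}h k : (k <= n.+1)%N -> regular2 q (q ^ (- (k : int)) * z).
  by move=> kn; have [] := h k kn.
suff H m : (m <= n.+1)%N -> egamma p q (q ^ (- (m : int)) * z)
    = (\prod_(l < m) theta p (z * q ^ (Negz l)))^-1 * egamma p q z.
  by rewrite NegzE H.
elim: m => [|m IH] mn; first by rewrite oppr0 expr0z mul1r big_ord0 invr1 mul1r.
rewrite big_ord_recr/= invfM mulrAC -IH ?(ltnW mn)//.
set w := q ^ (- (m.+1 : int)) * z.
have w0 : w != 0 by rewrite mulf_neq0 ?expfz_neq0.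
have e : q ^ (- (m : int)) * z = q * w.
  rewrite /w mulrA -{2}[q]expr1z -expfzDr//; congr (q ^ _ * _); lia.
(* A downward step divides by theta at w. It is nonzero by the regularity of w and the reflected
   regularity of q w, because p q / (q w) = p / w. *)
have [wr _] := h m.+1 mn; have [_ wr'] := h m (ltnW mn).
have t0 : theta p w != 0.
  apply: (theta_neq0 p1 q1) => //; move: wr'; rewrite e.
  by rewrite (_ : p * q / (q * w) = p / w)//; field; rewrite q0 w0.
rewrite e egamma_shift// NegzE [z * _]mulrC -/w; field; exact: t0.
Qed.

Lemma merogeneric_thetaz c d (s : int) : c != 0 -> d.1 != 0 ->
  merogeneric D (fun u => thetaz u.2 (c * mono d u) s).
Proof.
move=> c0 d0.
have H (l : int) : merogeneric D (fun u => theta p (c * mono d u * u.2 ^ l)).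
  apply: (@merogeneric_ext _ _ _ _ (fun u => theta p (c * mono (d + (0, l)) u))).
  - exact: open_domain.
  - by move=> u Du; rewrite monoD// monoq -mulrA.
  apply: merogeneric_nondegenerate; apply: nondegenerate_theta => //.
  by rewrite /= addr0.
case: s => n /=; last apply: merogenericV.
  by apply: merogeneric_prod => [|l]; [exact: open_domain|exact: H].
by apply: merogeneric_prod => [|l]; [exact: open_domain|exact: H].
Qed.

End RegularMonomials.

(** * Binomial coefficients of integers *)

Section IntegerBinomials.
Implicit Types (n : int).

Lemma int_step_ind (P : int -> Prop) : P 0 ->
  (forall n, P n -> P (n + 1)) -> (forall n, P (n + 1) -> P n) -> forall n, P n.
Proof.
move=> P0 PS PP; elim/int_rect => // n h.
  by rewrite -addn1 PoszD; exact: PS.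
by apply: PP; rewrite -addn1 PoszD opprD addrNK.
Qed.

(** Binomial coefficients extended to negative n; the divisions are exact by [binz2E] and [binz3E].
    As discrete antiderivatives ([binz2S], [binz3S]) they sum exponents along a run of thetas. *)
Definition binz2 n : int := (n * (n - 1) %/ 2)%Z.
Definition binz3 n : int := (n * (n - 1) * (n - 2) %/ 6)%Z.

Lemma binz2E n : binz2 n * 2 = n * (n - 1).
Proof.
suff [c e] : exists c, n * (n - 1) = c * 2 by rewrite /binz2 e mulzK.
elim/int_step_ind: n => [|n [c e]|n [c e]]; first by exists 0.
  by exists (c + n); lia.
by exists (c - n); lia.
Qed.

Lemma binz3E n : binz3 n * 6 = n * (n - 1) * (n - 2).
Proof.
suff [c e] : exists c, n * (n - 1) * (n - 2) = c * 6 by rewrite /binz3 e mulzK.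
elim/int_step_ind: n => [|n [c e]|n [c e]]; first by exists 0.
  by exists (c + binz2 n); have := binz2E n; lia.
by exists (c - binz2 n); have := binz2E n; lia.
Qed.

Lemma binz2S n : binz2 (n + 1) = binz2 n + n.
Proof. by have := binz2E n; have := binz2E (n + 1); lia. Qed.

Lemma binz3S n : binz3 (n + 1) = binz3 n + binz2 n.
Proof.
by have := binz2E n; have := binz3E n; have := binz3E (n + 1); lia.
Qed.

End IntegerBinomials.

(** * Quasi-periodicity of theta and of runs of thetas *)

Section QuasiPeriodicity.
Variables (R : realType) (p : R[i]).
Hypotheses (p1 : nc p < 1) (p0 : p != 0).
Implicit Types (q z : R[i]) (j e s : int).

Definition qmult j z : R[i] := (-1) ^ j * z ^ (- j) * p ^ (- binz2 j).

Lemma qmultS j z : z != 0 -> qmult (j + 1) z = - (p ^ j * z)^-1 * qmult j z.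
Proof.
move=> z0; rewrite /qmult binz2S !opprD !expfzDr// ?oppr_eq0 ?oner_eq0// -!invr_expz !expr1z.
rewrite invfM; ring.
Qed.

Lemma theta_quasi j z : z != 0 -> theta p (p ^ j * z) = qmult j z * theta p z.
Proof.
move=> z0.
have step k : theta p (p ^ (k + 1) * z) = - (p ^ k * z)^-1 * theta p (p ^ k * z).
  rewrite expfzDr// expr1z [p ^ k * p]mulrC -mulrA thetaMp//.
  by rewrite mulf_neq0 ?expfz_neq0.
have nz k : - (p ^ k * z)^-1 != 0 by rewrite oppr_eq0 invr_eq0 mulf_neq0 ?expfz_neq0.
elim/int_step_ind: j => [|j IH|j].
- by rewrite /qmult (_ : binz2 0 = 0)// oppr0 !expr0z !mul1r.
- by rewrite step qmultS// IH mulrA.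
- by rewrite step qmultS// -mulrA => /(mulfI (nz j)).
Qed.

Section Steps.
Variables (q z : R[i]) (j e : int) (A Cq Cp : int -> int).
Hypotheses (q0 : q != 0) (z0 : z != 0).
Hypotheses (A0 : A 0 = 0) (Cq0 : Cq 0 = 0) (Cp0 : Cp 0 = 0).
Hypothesis AS : forall s, A (s + 1) = A s + (j + e * s).
Hypothesis CqS : forall s, Cq (s + 1) = Cq s + s * (j + e * s).
Hypothesis CpS : forall s, Cp (s + 1) = Cp s + binz2 (j + e * s).

Let mu s : R[i] := (-1) ^ A s * z ^ (- A s) * q ^ (- Cq s) * p ^ (- Cp s).

Let muS s : mu (s + 1) = qmult (j + e * s) (z * q ^ s) * mu s.
Proof.
rewrite /mu /qmult AS CqS CpS; move: (j + e * s) => t; rewrite !opprD !expfzDr// ?oppr_eq0 ?oner_eq0//.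
rewrite expfzMl exprz_exp mulrN; ring.
Qed.

Let shiftE (l : int) : theta p (p ^ j * z * (p ^ e * q) ^ l)
  = qmult (j + e * l) (z * q ^ l) * theta p (z * q ^ l).
Proof.
rewrite -theta_quasi; last by rewrite mulf_neq0 ?expfz_neq0.
by congr theta; rewrite expfzMl exprz_exp expfzDr// mulrA; ring.
Qed.

(** The l-th argument is p^(j + e l) z q^l, and A, Cq, Cp sum j + e l, l (j + e l) and binz2 (j + e
    l) over 0 <= l < s. Their difference equations determine them for negative s too. The cases e =
    0 and e = 1 serve x_b -> p x_b and q -> p q. *)
Lemma thetaz_quasi s : thetaz p (p ^ e * q) (p ^ j * z) s
  = (-1) ^ A s * z ^ (- A s) * q ^ (- Cq s) * p ^ (- Cp s) * thetaz p q z s.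
Proof.
rewrite -/(mu s).
have mu0 : mu 0 = 1 by rewrite /mu A0 Cq0 Cp0 oppr0 !expr0z !mulr1.
have mun0 k : mu k != 0 by rewrite !mulf_neq0 ?expfz_neq0// oppr_eq0 oner_eq0.
case: s => n /=.
  under eq_bigr do rewrite shiftE.
  rewrite big_split/=; congr (_ * _).
  elim: n => [|n IH]; first by rewrite big_ord0 mu0.
  by rewrite big_ord_recr/= IH -addn1 PoszD muS mulrC.
under eq_bigr do rewrite shiftE.
rewrite big_split/= invfM; congr (_ * _).
rewrite NegzE; elim: (n.+1) => [|k IH]; first by rewrite big_ord0 invr1 oppr0 mu0.
rewrite big_ord_recr/= invfM IH.
have := muS (Negz k); rewrite NegzE.
rewrite (_ : - (k.+1 : int) + 1 = - (k : int)); last by lia.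
move=> ->; rewrite mulrC mulKf//.
by rewrite !mulf_neq0 ?expfz_neq0 ?mulf_neq0 ?expfz_neq0// oppr_eq0 oner_eq0.
Qed.

End Steps.

Lemma thetaz_quasi_p q z j s : q != 0 -> z != 0 -> thetaz p q (p ^ j * z) s
  = (-1) ^ (s * j) * z ^ (- (s * j)) * q ^ (- (binz2 s * j)) * p ^ (- (s * binz2 j))
    * thetaz p q z s.
Proof.
move=> q0 z0.
have := @thetaz_quasi q z j 0 (fun s => s * j) (fun s => binz2 s * j)
  (fun s => s * binz2 j) q0 z0.
rewrite expr0z mul1r; apply.
- by rewrite mul0r.
- by rewrite mul0r.
- by rewrite mul0r.
- by move=> k; ring.
- by move=> k; rewrite binz2S; ring.
- by move=> k; rewrite mul0r addr0; ring.
Qed.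

(** The exponent of q sums l j + l^2 with l^2 = 2 binz2 l + l; that of p telescopes through
    binz3. *)
Lemma thetaz_quasi_q q z j s : q != 0 -> z != 0 -> thetaz p (p * q) (p ^ j * z) s
  = (-1) ^ (s * j + binz2 s) * z ^ (- (s * j + binz2 s))
    * q ^ (- (binz2 s * j + (2 * binz3 s + binz2 s)))
    * p ^ (- (binz3 (j + s) - binz3 j)) * thetaz p q z s.
Proof.
move=> q0 z0.
have := @thetaz_quasi q z j 1 (fun s => s * j + binz2 s)
  (fun s => binz2 s * j + (2 * binz3 s + binz2 s))
  (fun s => binz3 (j + s) - binz3 j) q0 z0.
rewrite expr1z; apply.
- by rewrite mul0r.
- by rewrite mul0r.
- by rewrite addr0 subrr.
- by move=> k; rewrite binz2S; ring.
- by move=> k; have := binz2E k; rewrite binz2S binz3S; lia.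
- by move=> k; rewrite addrA binz3S mul1r; ring.
Qed.

End QuasiPeriodicity.

(** * Total ellipticity of products of elliptic gamma functions *)

Section GammaProducts.
Variables (R : realType) (N : nat) (p : R[i]).
Local Notation point := ('rV[R[i]]_N * R[i]^o)%type.
Local Notation D := (@term_domain R N).
Local Notation exponent := ('rV[int]_N * int)%type.
Implicit Types (u : point) (d : exponent) (a b : 'I_N) (c s : R[i]).
Hypotheses (p1 : nc p < 1) (p0 : p != 0).

(* The Laurent monomial [x ^ d.1 * (p q) ^ d.2]. *)
Definition arg d u : R[i] := p ^ d.2 * mono d u.

Lemma arg_neq0 d u : D u -> arg d u != 0.
Proof. by move=> Du; rewrite mulf_neq0 ?expfz_neq0 ?mono_neq0. Qed.

Lemma domain_scale b c u : c != 0 -> D u -> D (scale_var b c u.1, u.2).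
Proof.
move=> c0 /domainP[u0 q0 q1]; apply/domainP; split=> //= j.
by rewrite mxE; case: (j =P b) => _; [exact: mulf_neq0|exact: u0].
Qed.

Lemma domain_scaleq u : D u -> D (u.1, p * u.2).
Proof.
move=> /domainP[u0 q0 q1]; apply/domainP; split=> //=; first exact: mulf_neq0.
rewrite ncM; apply: le_lt_trans q1; rewrite ler_piMl ?nc_ge0//; exact: ltW.
Qed.

Lemma arg_scale d b c u : c != 0 -> D u ->
  arg d (scale_var b c u.1, u.2) = c ^ (d.1 0 b) * arg d u.
Proof. by move=> c0 Du; rewrite /arg mono_scale// mulrCA. Qed.

Lemma arg_scaleq d u : arg d (u.1, p * u.2) = p ^ d.2 * arg d u.
Proof. by rewrite /arg mono_scaleq. Qed.

Variable L : seq (exponent * int).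

Definition good (K : exponent -> nat) u := D u /\
  forall i, i \in L -> forall k, k \in iota 0 (K i.1).+1 ->
    regular2 p u.2 (u.2 ^ (k : int) * arg i.1 u) /\
    regular2 p u.2 (u.2 ^ (- (k : int)) * arg i.1 u).

(** Here [sh] stands for the identity, x_b -> p x_b or q -> p q; s is its action on q, and c d
    collects the powers of p in the argument. *)
Lemma generic_good K (sh : point -> point) s (c : exponent -> R[i]) :
  (forall i, i \in L -> i.1.1 != 0) ->
  s != 0 -> nc s <= 1 -> (forall d, c d != 0) ->
  (forall u, D u -> [/\ D (sh u), (sh u).2 = s * u.2 &
     forall d, arg d (sh u) = c d * mono d u]) ->
  generically D (fun u => good K (sh u)).
Proof.
move=> L0 s0 s1 c0 hsh.
have main i (k : int) : i \in L -> generically D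
    (fun u => regular2 p (s * u.2) (s ^ k * c i.1 * mono (i.1 + (0, k)) u)).
  move=> iL; apply: generic_regular2 => //; first by rewrite mulf_neq0 ?expfz_neq0.
  by rewrite /= addr0 L0.
apply: generic_sub (_ : forall u, D u /\ (forall i, i \in L ->
    forall k, k \in iota 0 (K i.1).+1 ->
    regular2 p (s * u.2) (s ^ (k : int) * c i.1 * mono (i.1 + (0, k : int)) u) /\
    regular2 p (s * u.2) (s ^ (- (k : int)) * c i.1 * mono (i.1 + (0, - (k : int))) u))
  -> _) _.
  move=> u [Du h]; have [Dsu qE argE] := hsh u Du; split=> // i iL k kK.
  have e (y x m : R[i]) (l : int) : (s * y) ^ l * (x * m) = s ^ l * x * (m * y ^ l).
    by rewrite expfzMl mulrACA [_ * m]mulrC.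
  by have := h i iL k kK; rewrite qE argE !monoD// !monoq !e.
apply: generic_and; first by apply: genericT => //; exact: open_domain.
apply: generic_all => [|i iL]; first exact: open_domain.
apply: generic_all => [|k _]; first exact: open_domain.
by apply: generic_and; exact: main.
Qed.

Variable Delta : 'rV[R[i]]_N -> R[i] -> R[i].
Hypothesis L0 : forall i, i \in L -> i.1.1 != 0.
Hypothesis DeltaE : forall u, D u ->
  Delta u.1 u.2 = \prod_(i <- L) egamma p u.2 (arg i.1 u) ^ i.2.

Definition theta_cert a u : R[i]^o :=
  \prod_(i <- L) thetaz p u.2 (arg i.1 u) (i.1.1 0 a) ^ i.2.

Lemma good_egamma K u i : good K u -> i \in L -> egamma p u.2 (arg i.1 u) != 0.
Proof.
move=> [/domainP[_ q0 q1] h] /h/(_ 0%N); rewrite mem_iota expr0z mul1r => -[]//.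
by move=> [h1 h2] _; exact: egamma_neq0.
Qed.

Lemma good_Delta K u : good K u -> Delta u.1 u.2 != 0.
Proof.
move=> h; rewrite DeltaE; last by case: h.
rewrite prodf_seq_neq0; apply/allP => i iL /=.
by rewrite expfz_neq0// (good_egamma h).
Qed.

Definition span a d : nat := absz (d.1 0 a).

Lemma certificateE a u : good (span a) u -> certificate Delta a u = theta_cert a u.
Proof.
move=> gu; have [Du h] := gu; have [_ q0 q1] := (domainP u).1 Du.
rewrite /certificate DeltaE// (DeltaE (domain_scale a q0 Du)) /theta_cert /=.
rewrite -prodf_div !big_seq; apply: eq_bigr => i iL.
rewrite arg_scale// egamma_shiftz ?arg_neq0//; last first.
  by move=> k kn; apply: h => //; rewrite mem_iota.
by rewrite expfzMl mulfK// expfz_neq0// (good_egamma gu).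
Qed.

Lemma merogeneric_exprz f (n : int) : merogeneric D f ->
  merogeneric D (fun u => f u ^ n : R[i]^o).
Proof.
move=> hf; have H k : merogeneric D (fun u => f u ^+ k : R[i]^o).
  elim: k => [|k IH].
    by apply: merogeneric_ext (@open_domain R N) _ (merogeneric1 (@open_domain R N)).
  apply: merogeneric_ext (@open_domain R N) _ (merogenericM hf IH) => u _.
  by rewrite exprS.
by case: n => k; [exact: H|exact: (merogenericV (H k.+1))].
Qed.

Lemma merogeneric_theta_cert a : merogeneric D (theta_cert a).
Proof.
rewrite /theta_cert; have : {subset L <= L} by [].
(* Only the traversed list is generalised, so that [L0] still applies to its members. *)
elim: {1 3}L => [|i l IH] lL.
  apply: merogeneric_ext (@open_domain R N) _ (merogeneric1 (@open_domain R N)) => u _.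
  by rewrite big_nil.
have lL' : {subset l <= L} by move=> j jl; apply: lL; rewrite in_cons jl orbT.
apply: merogeneric_ext (@open_domain R N) _ (merogenericM (merogeneric_exprz i.2
  (merogeneric_thetaz p1 p0 (i.1.1 0 a) (expfz_neq0 i.1.2 p0) (L0 (lL i (mem_head _ _)))))
  (IH lL')) => u _.
by rewrite big_cons.
Qed.

Definition weighted_sum (phi : exponent -> int) : int := \sum_(i <- L) i.2 * phi i.1.

(* The exponents of -1, of the independent variables, of q and of p in the
   product of quasi-periodicity factors vanish. *)
Definition trivial_multiplier (A Cq Cp : exponent -> int) := [/\
  exists k, weighted_sum A = 2 * k,
  forall b, weighted_sum (fun d => d.1 0 b * A d) = 0,
  weighted_sum (fun d => d.2 * A d + Cq d) = 0 &
  weighted_sum (fun d => d.2 * A d + Cp d) = 0].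

Lemma prod_exprz (I : Type) (l : seq I) (x : R[i]) (f : I -> int) : x != 0 ->
  \prod_(i <- l) x ^ f i = x ^ (\sum_(i <- l) f i).
Proof.
move=> x0; elim: l => [|i l IH]; first by rewrite !big_nil expr0z.
by rewrite !big_cons expfzDr// IH.
Qed.

(** An argument carries equal powers [d.2] of p and q, so its power -A adds [d.2 * A] to Cq as well
    as to Cp. *)
Lemma trivial_multiplierP A Cq Cp u : D u -> trivial_multiplier A Cq Cp ->
  \prod_(i <- L) ((-1) ^ A i.1 * arg i.1 u ^ (- A i.1) * u.2 ^ (- Cq i.1)
     * p ^ (- Cp i.1)) ^ i.2 = 1 :> R[i].
Proof.
move=> Du [[k hA] hx hq hp]; have [u0 q0 q1] := (domainP u).1 Du.
have n1 : -1 != 0 :> R[i] by rewrite oppr_eq0 oner_eq0.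
transitivity (\prod_(i <- L) ((-1) ^ (i.2 * A i.1)
    * \prod_b u.1 0 b ^ (- (i.2 * (i.1.1 0 b * A i.1)))
    * u.2 ^ (- (i.2 * (i.1.2 * A i.1 + Cq i.1)))
    * p ^ (- (i.2 * (i.1.2 * A i.1 + Cp i.1))))).
  apply: eq_bigr => i _; rewrite /arg /mono !expfzMl !exprz_exp.
  rewrite !(big_morph _ (fun x y => expfzMl x y _) (exp1rz _ _)).
  rewrite (eq_bigr (fun b => u.1 0 b ^ (- (i.2 * (i.1.1 0 b * A i.1))))) => [|b _].
    have e (x : R[i]) (C : int) : x != 0 -> x ^ (- (i.2 * (i.1.2 * A i.1 + C)))
        = x ^ (i.1.2 * (- A i.1 * i.2)) * x ^ (- C * i.2).
      by move=> x0; rewrite -expfzDr//; congr (x ^ _); ring.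
    rewrite !e// [A i.1 * _]mulrC; ring.
  by rewrite exprz_exp; congr (_ ^ _); ring.
have X b : \prod_(i <- L) u.1 0 b ^ (- (i.2 * (i.1.1 0 b * A i.1))) = 1.
  by rewrite prod_exprz// sumrN (_ : \sum_(i <- L) _ = 0) ?oppr0 ?expr0z//; exact: hx.
have S1 : \sum_(i <- L) i.2 * A i.1 = 2 * k := hA.
have Sq : \sum_(i <- L) i.2 * (i.1.2 * A i.1 + Cq i.1) = 0 := hq.
have Sp : \sum_(i <- L) i.2 * (i.1.2 * A i.1 + Cp i.1) = 0 := hp.
rewrite !big_split/= exchange_big/= (eq_bigr _ (fun b _ => X b)) big1_eq mulr1.
rewrite (prod_exprz _ _ n1) (prod_exprz _ _ q0) (prod_exprz _ _ p0).
rewrite !sumrN S1 Sq Sp oppr0 !expr0z !mulr1 -exprz_exp.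
by rewrite -exprnP sqrrN expr1n exp1rz.
Qed.

Hypothesis balanced_p : forall a b, trivial_multiplier
  (fun d => d.1 0 a * d.1 0 b) (fun d => binz2 (d.1 0 a) * d.1 0 b)
  (fun d => d.1 0 a * binz2 (d.1 0 b)).
Hypothesis balanced_q : forall a, trivial_multiplier
  (fun d => d.1 0 a * d.2 + binz2 (d.1 0 a))
  (fun d => binz2 (d.1 0 a) * d.2 + (2 * binz3 (d.1 0 a) + binz2 (d.1 0 a)))
  (fun d => binz3 (d.2 + d.1 0 a) - binz3 d.2).

(** For each factor, j is the exponent of x_b and s that of x_a. *)
Lemma theta_cert_p a b u : D u ->
  theta_cert a (scale_var b p u.1, u.2) = theta_cert a u.
Proof.
move=> Du; have [_ q0 _] := (domainP u).1 Du.
rewrite -[RHS]mul1r -(trivial_multiplierP Du (balanced_p a b)) -big_split/=.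
apply: eq_bigr => i _.
by rewrite arg_scale// thetaz_quasi_p ?arg_neq0// expfzMl.
Qed.

(** Here j is [d.2], the exponent of p q, and the step of each run of thetas changes from q to p q
    at the same time. *)
Lemma theta_cert_q a u : D u -> theta_cert a (u.1, p * u.2) = theta_cert a u.
Proof.
move=> Du; have [_ q0 _] := (domainP u).1 Du.
rewrite -[RHS]mul1r -(trivial_multiplierP Du (balanced_q a)) -big_split/=.
apply: eq_bigr => i _.
by rewrite arg_scaleq thetaz_quasi_q ?arg_neq0// expfzMl.
Qed.

Lemma totally_elliptic_gamma_product : totally_elliptic_term p Delta.
Proof.
have G K : generically D (good K).
  apply: (@generic_good K id 1 (fun d => p ^ d.2)) => //; rewrite ?oner_neq0 ?nc1//.
    by move=> d; rewrite expfz_neq0.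
  by move=> u Du; rewrite mul1r.
split; first by apply: generic_sub (G (fun=> 0%N)) => u /good_Delta.
move=> a; split.
- apply: merogeneric_meromorphic (merogeneric_theta_cert a) _.
  by apply: generic_sub (G (span a)) => u; exact: certificateE.
- move=> b; have Gb : generically D (fun u => good (span a) (scale_var b p u.1, u.2)).
    apply: (@generic_good _ _ 1 (fun d => p ^ (d.1 0 b) * p ^ d.2)).
    - exact: L0.
    - exact: oner_neq0.
    - by rewrite nc1.
    - by move=> d; rewrite mulf_neq0 ?expfz_neq0.
    move=> u Du; split=> [||d]; [exact: domain_scale|by rewrite mul1r|].
    by rewrite arg_scale// mulrA.
  apply: generic_sub (generic_and (G (span a)) Gb) => u [gu gu'].
  rewrite (certificateE gu) (certificateE gu').
  by apply: theta_cert_p; case: gu.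
(* The base itself becomes p q, hence s = p, and two factors p^(d.2) meet: one from the definition
   of [arg], one from the substitution. *)
- have Gq : generically D (fun u => good (span a) (u.1, p * u.2)).
    apply: (@generic_good _ _ p (fun d => p ^ d.2 * p ^ d.2)).
    - exact: L0.
    - exact: p0.
    - exact: ltW.
    - by move=> d; rewrite mulf_neq0 ?expfz_neq0.
    move=> u Du; split=> [||d]; [exact: domain_scaleq|by []|].
    by rewrite arg_scaleq mulrA.
  apply: generic_sub (generic_and (G (span a)) Gq) => u [gu gu'].
  rewrite (certificateE gu) (certificateE gu').
  by apply: theta_cert_q; case: gu.
Qed.

End GammaProducts.

(** * Sums over pairs of indices *)

Section IntegerSums.

(** By symmetry both triangles have the same sum; full double sums can then be factored by
    [sum_rect]. *)
Lemma sum_upper_lower k (f : 'I_k -> 'I_k -> int) : (forall r s, f r s = f s r) ->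
  2 * (\sum_(r < k) \sum_(s < k | (r < s)%N) f r s)
  = \sum_(r < k) \sum_(s < k) f r s - \sum_(r < k) f r r.
Proof.
move=> fC; apply/eqP; rewrite eq_sym subr_eq; apply/eqP.
set U := \sum_(r < k) \sum_(s < k | (r < s)%N) f r s.
have lower : \sum_(r < k) \sum_(s < k | (s < r)%N) f r s = U.
  rewrite (exchange_big_dep xpredT)//=; apply: eq_bigr => s _.
  by apply: eq_bigr => r _.
rewrite mulrDl mul1r -{2}lower -!big_split/=; apply: eq_bigr => r _.
rewrite (bigID (fun s : 'I_k => (r < s)%N))/= -addrA; congr (_ + _).
rewrite (bigD1 r) ?ltnn//= addrC; congr (_ + _); apply: eq_bigl => s.
by rewrite -leqNgt ltn_neqAle andbC.
Qed.

Lemma sum_rect k l (f : 'I_k -> int) (g : 'I_l -> int)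
    (u1 u2 u3 : 'I_k -> int) (v1 v2 v3 : 'I_l -> int) :
  \sum_(r < k) \sum_(j < l) (f r + g j + (u1 r * v1 j + u2 r * v2 j + u3 r * v3 j))
  = l%:Z * (\sum_r f r) + k%:Z * (\sum_j g j) + ((\sum_r u1 r) * (\sum_j v1 j)
    + (\sum_r u2 r) * (\sum_j v2 j) + (\sum_r u3 r) * (\sum_j v3 j)).
Proof.
under eq_bigr do rewrite !big_split/= -!mulr_sumr.
rewrite !big_split/= -!mulr_suml; congr (_ + _ + _).
  rewrite mulr_sumr; apply: eq_bigr => r _.
  by rewrite sumr_const card_ord -mulr_natl natz.
by rewrite sumr_const card_ord -mulr_natl natz.
Qed.

(** In degree e the full double sum contains 2 k copies of the single sum and the diagonal 2^e;
    halving gives the coefficients k - 1, k - 2, k - 4 in degrees 1, 2, 3. *)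
Lemma pair_sum1 k (a : 'I_k -> int) :
  \sum_(r < k) \sum_(s < k | (r < s)%N) (a r + a s) = (k%:Z - 1) * \sum_r a r.
Proof.
apply: (@mulfI _ 2) => //; rewrite sum_upper_lower => [|r s]; last exact: addrC.
have := @sum_rect k k a a a a a (fun=> 0) (fun=> 0) (fun=> 0).
rewrite !big1_eq !mulr0 !addr0.
under eq_bigr do under eq_bigr do rewrite !mulr0 !addr0.
by move=> ->; rewrite big_split/=; ring.
Qed.

Lemma pair_sum2 k (a b : 'I_k -> int) :
  \sum_(r < k) \sum_(s < k | (r < s)%N) ((a r + a s) * (b r + b s))
  = (k%:Z - 2) * (\sum_r a r * b r) + (\sum_r a r) * (\sum_r b r).
Proof.
apply: (@mulfI _ 2) => //; rewrite sum_upper_lower => [|r s]; last by ring.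
have := @sum_rect k k (fun r => a r * b r) (fun r => a r * b r) a b a b a (fun=> 0).
rewrite !big1_eq !mulr0 !addr0.
move=> e; rewrite [X in _ - X](eq_bigr (fun r => 4 * (a r * b r))) => [|r _].
  2: by ring.
rewrite -mulr_sumr; apply/eqP; rewrite subr_eq; apply/eqP.
transitivity (k%:Z * (\sum_r a r * b r) + k%:Z * (\sum_r a r * b r)
   + ((\sum_r a r) * (\sum_r b r) + (\sum_r b r) * (\sum_r a r))); last by ring.
by rewrite -e; apply: eq_bigr => r _; apply: eq_bigr => s _; ring.
Qed.

Lemma pair_sum3 k (a b c : 'I_k -> int) :
  \sum_(r < k) \sum_(s < k | (r < s)%N) ((a r + a s) * (b r + b s) * (c r + c s))
  = (k%:Z - 4) * (\sum_r a r * b r * c r) + (\sum_r a r) * (\sum_r b r * c r)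
    + (\sum_r b r) * (\sum_r a r * c r) + (\sum_r c r) * (\sum_r a r * b r).
Proof.
apply: (@mulfI _ 2) => //; rewrite sum_upper_lower => [|r s]; last by ring.
(* The expansion has six mixed terms and [sum_rect] takes three, so it is applied once to each
   half. *)
have := @sum_rect k k (fun r => a r * b r * c r) (fun=> 0)
  a b c (fun r => b r * c r) (fun r => a r * c r) (fun r => a r * b r).
have := @sum_rect k k (fun=> 0) (fun r => a r * b r * c r)
  (fun r => b r * c r) (fun r => a r * c r) (fun r => a r * b r) a b c.
rewrite !big1_eq !mulr0 !addr0 !add0r => e1 e2.
rewrite [X in _ - X](eq_bigr (fun r => 8 * (a r * b r * c r))) => [|r _]; last by ring.
rewrite -mulr_sumr; apply/eqP; rewrite subr_eq; apply/eqP.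
transitivity (\sum_(r < k) \sum_(s < k) (0 + a s * b s * c s +
      (b r * c r * a s + a r * c r * b s + a r * b r * c s))
  + \sum_(r < k) \sum_(s < k) (a r * b r * c r + 0 +
      (a r * (b s * c s) + b r * (a s * c s) + c r * (a s * b s)))).
  rewrite -big_split/=; apply: eq_bigr => r _.
  by rewrite -big_split/=; apply: eq_bigr => s _; ring.
rewrite e1 e2; ring.
Qed.

End IntegerSums.

(** * Gamma products as lists of exponents with multiplicities *)

Section FormalProducts.
Variables (R : realType) (N : nat) (p : R[i]).
Local Notation point := ('rV[R[i]]_N * R[i]^o)%type.
Local Notation D := (@term_domain R N).
Local Notation exponent := ('rV[int]_N * int)%type.
Implicit Types (u : point) (d : exponent) (L : seq (exponent * int)).
Hypothesis p0 : p != 0.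

Definition gamma_of u L : R[i] := \prod_(i <- L) egamma p u.2 (arg p i.1 u) ^ i.2.
Definition inv_list L := [seq (i.1, - i.2) | i <- L].
Definition nonconstant L := all (fun i : exponent * int => i.1.1 != 0) L.

Lemma gamma_of_cat u L L' : gamma_of u (L ++ L') = gamma_of u L * gamma_of u L'.
Proof. exact: big_cat. Qed.

Lemma gamma_of_bigcat u (I : Type) (r : seq I) (P : pred I)
    (F : I -> seq (exponent * int)) :
  gamma_of u (\big[cat/[::]]_(i <- r | P i) F i)
  = \prod_(i <- r | P i) gamma_of u (F i).
Proof. by apply: (big_morph _ (gamma_of_cat u)); exact: big_nil. Qed.

Lemma gamma_of_inv u L : gamma_of u (inv_list L) = (gamma_of u L)^-1.
Proof.
rewrite /gamma_of big_map -prodfV; apply: eq_bigr => i _ /=.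
by rewrite invr_expz.
Qed.

Lemma gamma_of_nil u : gamma_of u [::] = 1.
Proof. exact: big_nil. Qed.

Lemma gamma_of1 u d : gamma_of u [:: (d, 1)] = egamma p u.2 (arg p d u).
Proof. by rewrite /gamma_of big_seq1 expr1z. Qed.

Lemma gamma_of_cons u d L :
  gamma_of u ((d, 1) :: L) = egamma p u.2 (arg p d u) * gamma_of u L.
Proof. by rewrite -cat1s gamma_of_cat gamma_of1. Qed.

Lemma weighted_sum_cat L L' phi :
  weighted_sum (L ++ L') phi = weighted_sum L phi + weighted_sum L' phi.
Proof. exact: big_cat. Qed.

Lemma weighted_sum_bigcat (I : Type) (r : seq I) (P : pred I)
    (F : I -> seq (exponent * int)) phi :
  weighted_sum (\big[cat/[::]]_(i <- r | P i) F i) phi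
  = \sum_(i <- r | P i) weighted_sum (F i) phi.
Proof.
by apply: (big_morph (@weighted_sum N ^~ phi) (fun L L' => weighted_sum_cat L L' phi)); exact: big_nil.
Qed.

Lemma weighted_sum_inv L phi : weighted_sum (inv_list L) phi = - weighted_sum L phi.
Proof.
rewrite /weighted_sum big_map -sumrN; apply: eq_bigr => i _ /=.
by rewrite mulNr.
Qed.

Lemma weighted_sum_cons d L phi :
  weighted_sum ((d, 1) :: L) phi = phi d + weighted_sum L phi.
Proof. by rewrite /weighted_sum big_cons mul1r. Qed.

Lemma weighted_sum_nil phi : weighted_sum ([::] : seq (exponent * int)) phi = 0.
Proof. exact: big_nil. Qed.

Lemma weighted_sum1 d phi : weighted_sum [:: (d, 1)] phi = phi d.
Proof. by rewrite /weighted_sum big_seq1 mul1r. Qed.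

Lemma nonconstant_bigcat (I : Type) (r : seq I) (P : pred I)
    (F : I -> seq (exponent * int)) :
  (forall i, P i -> nonconstant (F i)) ->
  nonconstant (\big[cat/[::]]_(i <- r | P i) F i).
Proof.
move=> h; apply: (big_ind nonconstant) => // L L'.
by rewrite /nonconstant all_cat => -> ->.
Qed.

Lemma nonconstant_cons d L :
  nonconstant ((d, 1) :: L) = (d.1 != 0) && nonconstant L.
Proof. by []. Qed.

Lemma nonconstant_inv L : nonconstant (inv_list L) = nonconstant L.
Proof. by rewrite /nonconstant all_map; apply: eq_all. Qed.

Lemma argD d d' u : D u -> arg p (d + d') u = arg p d u * arg p d' u.
Proof. by move=> Du; rewrite /arg monoD//= expfzDr// mulrACA. Qed.

Lemma argN d u : arg p (- d) u = (arg p d u)^-1.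
Proof. by rewrite /arg monoN [RHS]invfM invr_expz. Qed.

End FormalProducts.

(** * The exponent list of rho *)

Section RhoExponents.
Variables (n m : nat).
Local Notation k := (2 * n + 2 * m + 3)%N.
Local Notation N := (n + m + k)%N.
Local Notation exponent := ('rV[int]_N * int)%type.

Definition unitexp (j : 'I_N) : exponent := (delta_mx 0 j, 0).
Definition zexp (i : 'I_n) := unitexp (lshift k (lshift m i)).
Definition yexp (j : 'I_m) := unitexp (lshift k (rshift n j)).
Definition pqexp : exponent := (0, 1).
Definition texp (r : 'I_k.+1) : exponent :=
  if unlift ord_max r is Some s then unitexp (rshift (n + m) s)
  else pqexp *+ m.+1 - \sum_(s < k) unitexp (rshift (n + m) s).

Local Notation g d := (d, 1 : int).

Definition ttlist r s := [:: g (texp r + texp s)].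
Definition yylist i j := [:: g (yexp i + yexp j - pqexp); g (pqexp - (yexp i + yexp j));
  g (yexp i - yexp j); g (yexp j - yexp i)].
Definition zzlist i j := [:: g (zexp i + zexp j); g (zexp i - zexp j);
  g (- zexp i + zexp j); g (- zexp i - zexp j)].
Definition y2list j := [:: g (yexp j + yexp j - pqexp); g (pqexp - (yexp j + yexp j))].
Definition z2list j := [:: g (zexp j + zexp j); g (- (zexp j + zexp j))].
Definition tzlist r j := [:: g (texp r + zexp j); g (texp r - zexp j)].
Definition tylist r j := [:: g (yexp j - texp r); g (pqexp - (texp r + yexp j))].

(** The blocks follow the factors of [rho_explicit], denominators becoming inverted lists. *)
Definition rho_list : seq (exponent * int) :=
  (\big[cat/[::]]_(r < k.+1) \big[cat/[::]]_(s < k.+1 | (r < s)%N) inv_list (ttlist r s))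
  ++ ((\big[cat/[::]]_(i < m) \big[cat/[::]]_(j < m | (i < j)%N) yylist i j)
     ++ inv_list (\big[cat/[::]]_(i < n) \big[cat/[::]]_(j < n | (i < j)%N) zzlist i j))
  ++ ((\big[cat/[::]]_(j < m) y2list j) ++ inv_list (\big[cat/[::]]_(j < n) z2list j))
  ++ \big[cat/[::]]_(r < k.+1) ((\big[cat/[::]]_(j < n) tzlist r j)
     ++ inv_list (\big[cat/[::]]_(j < m) tylist r j)).

Section Evaluation.
Variables (R : realType) (p : R[i]).
Hypothesis p0 : p != 0.
Local Notation point := ('rV[R[i]]_N * R[i]^o)%type.
Local Notation D := (@term_domain R N).
Variable u : point.
Hypothesis Du : D u.

Lemma arg_unitexp j : arg p (unitexp j) u = u.1 0 j.
Proof.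
rewrite /arg /mono /unitexp /= !expr0z mul1r mulr1 (bigD1 j)//= mxE !eqxx expr1z.
by rewrite big1 ?mulr1// => i ij; rewrite mxE (negbTE ij).
Qed.

Lemma arg_pq : arg p pqexp u = p * u.2.
Proof. by rewrite /arg monoq !expr1z. Qed.

Lemma arg_zexp i : arg p (zexp i) u = lsubmx (lsubmx u.1) 0 i.
Proof. by rewrite arg_unitexp !mxE. Qed.

Lemma arg_yexp j : arg p (yexp j) u = rsubmx (lsubmx u.1) 0 j.
Proof. by rewrite arg_unitexp !mxE. Qed.

Lemma arg_texp r : arg p (texp r) u = balanced ((p * u.2) ^+ m.+1) (rsubmx u.1) r.
Proof.
have a0 : arg p (0 : exponent) u = 1.
  by rewrite -(subrr (0 : exponent)) argD// argN divff// arg_neq0.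
rewrite /texp /balanced; case: unliftP => [s _|_]; first by rewrite arg_unitexp mxE.
rewrite argD// argN; congr (_ / _).
  elim: (m.+1) => [|M IH]; first by rewrite mulr0n expr0 a0.
  by rewrite mulrS argD// arg_pq IH exprS.
rewrite (big_morph (fun d => arg p d u) (id1 := 1) (op1 := *%R)) => //.
  by apply: eq_bigr => s _; rewrite arg_unitexp mxE.
by move=> d d'; exact: argD.
Qed.

Lemma gamma_of_rho : gamma_of p u rho_list = rho_indep n m p u.1 u.2.
Proof.
have [_ q0 _] := (domainP u).1 Du.
rewrite /rho_indep rho_explicit// /rho_list !gamma_of_cat !gamma_of_inv.
rewrite -[RHS]mulrA -[RHS]mulrA !gamma_of_bigcat.
have yy i j : gamma_of p u (yylist i j) =
    egamma p u.2 (rsubmx (lsubmx u.1) 0 i * rsubmx (lsubmx u.1) 0 j / (p * u.2))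
    * egamma p u.2 (p * u.2 / (rsubmx (lsubmx u.1) 0 i * rsubmx (lsubmx u.1) 0 j))
    * egamma p u.2 (rsubmx (lsubmx u.1) 0 i / rsubmx (lsubmx u.1) 0 j)
    * egamma p u.2 (rsubmx (lsubmx u.1) 0 j / rsubmx (lsubmx u.1) 0 i).
  by rewrite !gamma_of_cons gamma_of_nil mulr1 !(argD, argN)// arg_pq !arg_yexp !mulrA.
have zz i j : gamma_of p u (zzlist i j) =
    egamma_pmpm p u.2 (lsubmx (lsubmx u.1) 0 i) (lsubmx (lsubmx u.1) 0 j).
  by rewrite !gamma_of_cons gamma_of_nil mulr1 !(argD, argN)// !arg_zexp /egamma_pmpm !mulrA.
have y2 j : gamma_of p u (y2list j) =
    egamma p u.2 (rsubmx (lsubmx u.1) 0 j ^+ 2 / (p * u.2))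
    * egamma p u.2 (p * u.2 / rsubmx (lsubmx u.1) 0 j ^+ 2).
  by rewrite gamma_of_cons gamma_of1 !(argD, argN)// arg_pq !arg_yexp.
have z2 j : gamma_of p u (z2list j) = egamma_pm2 p u.2 (lsubmx (lsubmx u.1) 0 j).
  by rewrite gamma_of_cons gamma_of1 !(argD, argN)// !arg_zexp.
have tz r j : gamma_of p u (tzlist r j) = egamma_pm p u.2
    (balanced ((p * u.2) ^+ m.+1) (rsubmx u.1) r) (lsubmx (lsubmx u.1) 0 j).
  by rewrite gamma_of_cons gamma_of1 !(argD, argN)// !arg_zexp !arg_texp.
have ty r j : gamma_of p u (tylist r j) =
    egamma p u.2 (rsubmx (lsubmx u.1) 0 j / balanced ((p * u.2) ^+ m.+1) (rsubmx u.1) r)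
    * egamma p u.2 (p * u.2 / (balanced ((p * u.2) ^+ m.+1) (rsubmx u.1) r
                               * rsubmx (lsubmx u.1) 0 j)).
  by rewrite gamma_of_cons gamma_of1 !(argD, argN)// arg_pq !arg_yexp !arg_texp.
congr (_ * (_ / _ * (_ / _ * _))).
- apply: eq_bigr => r _; rewrite gamma_of_bigcat; apply: eq_bigr => s _.
  by rewrite gamma_of_inv gamma_of1 argD// !arg_texp.
- by apply: eq_bigr => i _; rewrite gamma_of_bigcat; apply: eq_bigr => j _.
- by apply: eq_bigr => i _; rewrite gamma_of_bigcat; apply: eq_bigr => j _.
- by apply: eq_bigr => j _.
- by apply: eq_bigr => j _.
apply: eq_bigr => r _; rewrite gamma_of_cat gamma_of_inv !gamma_of_bigcat.
by congr (_ / _); apply: eq_bigr => j _.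
Qed.

End Evaluation.
End RhoExponents.

(** * Evaluation of the weighted sums of rho *)

Section RhoWeights.
Variables (n m : nat).
Local Notation k := (2 * n + 2 * m + 3)%N.
Local Notation N := (n + m + k)%N.
Local Notation exponent := ('rV[int]_N * int)%type.
Local Notation K := (k.+1%:Z).
Local Notation T := (@texp n m).
Local Notation z := (@zexp n m).
Local Notation y := (@yexp n m).
Local Notation pq := (@pqexp n m).
Local Notation S := (weighted_sum (rho_list n m)).
Implicit Types (l : exponent -> int) (phi : exponent -> int).

Definition is_linear l :=
  [/\ l 0 = 0, forall d d', l (d + d') = l d + l d' & forall d, l (- d) = - l d].

Lemma sum_texp : \sum_(r < k.+1) T r = pq *+ m.+1.
Proof.
rewrite big_ord_recr/= {2}/texp unlift_none.
rewrite (eq_bigr (fun s : 'I_k => unitexp (rshift (n + m) s))) => [|s _].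
  by rewrite addrC subrK.
rewrite /texp (_ : widen_ord _ _ = lift ord_max s) ?liftK//.
by apply: val_inj; rewrite /= /bump leqNgt ltn_ord.
Qed.

Lemma is_linear_sum (I : Type) (r : seq I) (F : I -> exponent) l : is_linear l ->
  l (\sum_(i <- r) F i) = \sum_(i <- r) l (F i).
Proof. by move=> [l0 lD _]; exact: (big_morph l lD l0). Qed.

Lemma is_linear_muln d M l : is_linear l -> l (d *+ M) = M%:Z * l d.
Proof.
move=> [l0 lD _]; elim: M => [|M IH]; first by rewrite mulr0n l0 mul0r.
by rewrite mulrS lD IH -add1n PoszD mulrDl mul1r.
Qed.

Lemma linear_texp l : is_linear l -> \sum_(r < k.+1) l (T r) = m.+1%:Z * l pq.
Proof. by move=> hl; rewrite -is_linear_sum// sum_texp is_linear_muln. Qed.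

Lemma weighted_sum_rho phi : S phi =
  - (\sum_(r < k.+1) \sum_(s < k.+1 | (r < s)%N) phi (T r + T s))
  + (\sum_(i < m) \sum_(j < m | (i < j)%N) (phi (y i + y j - pq)
       + phi (pq - (y i + y j)) + phi (y i - y j) + phi (y j - y i))
    - \sum_(i < n) \sum_(j < n | (i < j)%N) (phi (z i + z j) + phi (z i - z j)
       + phi (- z i + z j) + phi (- z i - z j)))
  + (\sum_(j < m) (phi (y j + y j - pq) + phi (pq - (y j + y j)))
    - \sum_(j < n) (phi (z j + z j) + phi (- (z j + z j))))
  + (\sum_(r < k.+1) \sum_(j < n) (phi (T r + z j) + phi (T r - z j))
    - \sum_(r < k.+1) \sum_(j < m) (phi (y j - T r) + phi (pq - (T r + y j)))).
Proof.
rewrite /rho_list !weighted_sum_cat !weighted_sum_inv !weighted_sum_bigcat.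
rewrite -[RHS]addrA -[RHS]addrA; congr (_ + (_ - _ + (_ - _ + _))).
- rewrite -sumrN; apply: eq_bigr => r _; rewrite weighted_sum_bigcat -sumrN.
  by apply: eq_bigr => s _; rewrite weighted_sum_inv weighted_sum1.
- apply: eq_bigr => i _; rewrite weighted_sum_bigcat; apply: eq_bigr => j _.
  by rewrite !weighted_sum_cons weighted_sum_nil addr0 !addrA.
- apply: eq_bigr => i _; rewrite weighted_sum_bigcat; apply: eq_bigr => j _.
  by rewrite !weighted_sum_cons weighted_sum_nil addr0 !addrA.
- by apply: eq_bigr => j _; rewrite weighted_sum_cons weighted_sum1.
- by apply: eq_bigr => j _; rewrite weighted_sum_cons weighted_sum1.
rewrite -sumrB; apply: eq_bigr => r _.
rewrite weighted_sum_cat weighted_sum_inv !weighted_sum_bigcat.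
by congr (_ - _); apply: eq_bigr => j _; rewrite weighted_sum_cons weighted_sum1.
Qed.

(** In the blocks of pairs of y or of z the four terms cancel all mixed contributions, leaving f i +
    f j. The blocks pairing t with z or y keep products of an r-part and a j-part, whose sums
    factor. *)
Lemma weighted_sum_rho_eval phi X (fy gy hy v1' v2' v3' : 'I_m -> int)
    (fz gz hz v1 v2 v3 : 'I_n -> int) (ft ft' u1 u2 u3 u1' u2' u3' : 'I_k.+1 -> int) :
  \sum_(r < k.+1) \sum_(s < k.+1 | (r < s)%N) phi (T r + T s) = X ->
  (forall i j, phi (y i + y j - pq) + phi (pq - (y i + y j)) + phi (y i - y j)
     + phi (y j - y i) = fy i + fy j) ->
  (forall i j, phi (z i + z j) + phi (z i - z j) + phi (- z i + z j)
     + phi (- z i - z j) = fz i + fz j) ->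
  (forall j, phi (y j + y j - pq) + phi (pq - (y j + y j)) = gy j) ->
  (forall j, phi (z j + z j) + phi (- (z j + z j)) = gz j) ->
  (forall r j, phi (T r + z j) + phi (T r - z j)
     = ft r + hz j + (u1 r * v1 j + u2 r * v2 j + u3 r * v3 j)) ->
  (forall r j, phi (y j - T r) + phi (pq - (T r + y j))
     = ft' r + hy j + (u1' r * v1' j + u2' r * v2' j + u3' r * v3' j)) ->
  S phi = - X + ((m%:Z - 1) * (\sum_j fy j) - (n%:Z - 1) * (\sum_j fz j))
   + (\sum_j gy j - \sum_j gz j)
   + ((n%:Z * (\sum_r ft r) + K * (\sum_j hz j) + ((\sum_r u1 r) * (\sum_j v1 j)
        + (\sum_r u2 r) * (\sum_j v2 j) + (\sum_r u3 r) * (\sum_j v3 j)))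
     - (m%:Z * (\sum_r ft' r) + K * (\sum_j hy j) + ((\sum_r u1' r) * (\sum_j v1' j)
        + (\sum_r u2' r) * (\sum_j v2' j) + (\sum_r u3' r) * (\sum_j v3' j)))).
Proof.
move=> hX hyy hzz hy2 hz2 htz hty; rewrite weighted_sum_rho hX.
congr (_ + (_ - _) + (_ - _) + (_ - _)).
- by rewrite -pair_sum1; apply: eq_bigr => i _; apply: eq_bigr => j _.
- by rewrite -pair_sum1; apply: eq_bigr => i _; apply: eq_bigr => j _.
- by apply: eq_bigr => j _.
- by apply: eq_bigr => j _.
- by rewrite -sum_rect; apply: eq_bigr => r _; apply: eq_bigr => j _.
- by rewrite -sum_rect; apply: eq_bigr => r _; apply: eq_bigr => j _.
Qed.

(** Models the exponent of an independent variable; vanishing at [pq] turns the balancing condition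
    into \sum_r l (T r) = 0. *)
Definition is_xweight l := is_linear l /\ l pq = 0.

Lemma xweight_coord (a : 'I_N) : is_xweight (fun d => d.1 0 a).
Proof. by split; [split|] => [|d d'|d|]; rewrite /= mxE. Qed.

Lemma xweight_texp l : is_xweight l -> \sum_(r < k.+1) l (T r) = 0.
Proof. by move=> [hl l0]; rewrite linear_texp// l0 mulr0. Qed.

Local Notation b r := (T r).2.

Lemma sum_b : \sum_(r < k.+1) b r = m%:Z + 1.
Proof.
have : is_linear (fun d : exponent => d.2) by split.
by move=> /linear_texp ->; rewrite mulr1 -addn1 PoszD.
Qed.

Lemma K_E : K = 2 * n%:Z + 2 * m%:Z + 4.
Proof. lia. Qed.

Let zero {I : Type} : I -> int := fun=> 0.

Lemma rho_weight1 l : is_xweight l -> S l = 0.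
Proof.
move=> hl; have tl := xweight_texp hl; case: hl => -[_ lD lN] lpq.
rewrite (@weighted_sum_rho_eval _ ((K - 1) * \sum_r l (T r)) zero zero zero zero zero zero
  zero zero zero zero zero zero (fun r => 2 * l (T r)) (fun r => - 2 * l (T r))
  zero zero zero zero zero zero) /zero.
- by rewrite -!mulr_sumr tl !big1_eq; ring.
- by rewrite -pair_sum1; apply: eq_bigr => r _; apply: eq_bigr => s _; rewrite lD.
all: by move=> *; rewrite !(lD, lN) ?lpq; ring.
Qed.

(** The quadratic sum need not vanish; the evenness of its coefficients gives the sign condition for
    x_b -> p x_b. *)
Lemma rho_weight2 l l' : is_xweight l -> is_xweight l' ->
  S (fun d => l d * l' d) = (4 * m%:Z + 4) * (\sum_j l (z j) * l' (z j))
    - (4 * n%:Z + 4) * (\sum_j l (y j) * l' (y j))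
    - (4 * m%:Z + 2) * (\sum_r l (T r) * l' (T r)).
Proof.
move=> hl hl'; have [tl tl'] := (xweight_texp hl, xweight_texp hl').
case: hl hl' => -[_ lD lN] lpq [[_ lD' lN'] lpq'].
rewrite (@weighted_sum_rho_eval _ ((K - 2) * (\sum_r l (T r) * l' (T r))
    + (\sum_r l (T r)) * (\sum_r l' (T r)))
  (fun j => 4 * (l (y j) * l' (y j))) (fun j => 8 * (l (y j) * l' (y j)))
  (fun j => 2 * (l (y j) * l' (y j))) zero zero zero
  (fun j => 4 * (l (z j) * l' (z j))) (fun j => 8 * (l (z j) * l' (z j)))
  (fun j => 2 * (l (z j) * l' (z j))) zero zero zero
  (fun r => 2 * (l (T r) * l' (T r))) (fun r => 2 * (l (T r) * l' (T r)))
  zero zero zero zero zero zero) /zero.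
- by rewrite -!mulr_sumr tl tl' !big1_eq K_E; ring.
- by rewrite -pair_sum2; apply: eq_bigr => r _; apply: eq_bigr => s _; rewrite lD lD'.
all: by move=> *; rewrite !(lD, lN, lD', lN') ?lpq ?lpq'; ring.
Qed.

(** Mixed terms contain a sum of a weight over all T r, which is 0. The cubic sum over the t_r has
    coefficient -(K - 4) + 2 n + 2 m, which vanishes for exactly K = 2 n + 2 m + 4 parameters. *)
Lemma rho_weight3 l l' l'' : is_xweight l -> is_xweight l' -> is_xweight l'' ->
  S (fun d => l d * l' d * l'' d) = 0.
Proof.
move=> hl hl' hl''.
have [[tl tl'] tl''] := (xweight_texp hl, xweight_texp hl', xweight_texp hl'').
case: hl hl' hl'' => -[_ lD lN] lpq [[_ lD' lN'] lpq'] [[_ lD'' lN''] lpq''].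
rewrite (@weighted_sum_rho_eval _ ((K - 4) * (\sum_r l (T r) * l' (T r) * l'' (T r))
    + (\sum_r l (T r)) * (\sum_r l' (T r) * l'' (T r))
    + (\sum_r l' (T r)) * (\sum_r l (T r) * l'' (T r))
    + (\sum_r l'' (T r)) * (\sum_r l (T r) * l' (T r)))
  zero zero zero (fun j => l' (y j) * l'' (y j)) (fun j => l (y j) * l'' (y j))
    (fun j => l (y j) * l' (y j))
  zero zero zero (fun j => l' (z j) * l'' (z j)) (fun j => l (z j) * l'' (z j))
    (fun j => l (z j) * l' (z j))
  (fun r => 2 * (l (T r) * l' (T r) * l'' (T r)))
  (fun r => - 2 * (l (T r) * l' (T r) * l'' (T r)))
  (fun r => 2 * l (T r)) (fun r => 2 * l' (T r)) (fun r => 2 * l'' (T r))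
  (fun r => - 2 * l (T r)) (fun r => - 2 * l' (T r)) (fun r => - 2 * l'' (T r))) /zero.
- by rewrite -!mulr_sumr tl tl' tl'' !big1_eq K_E; ring.
- rewrite -pair_sum3; apply: eq_bigr => r _; apply: eq_bigr => s _.
  by rewrite lD lD' lD''.
all: by move=> *; rewrite !(lD, lN, lD', lN', lD'', lN'') ?lpq ?lpq' ?lpq''; ring.
Qed.

(** The balancing exponent enters here: \sum_r b r = m + 1 gives the z-terms the coefficient 2 (m +
    1), half of that in [rho_weight2]. *)
Lemma rho_weight_b2 l l' : is_xweight l -> is_xweight l' ->
  2 * S (fun d => d.2 * l d * l' d) = S (fun d => l d * l' d).
Proof.
move=> hl hl'; rewrite [RHS]rho_weight2//.
have [tl tl'] := (xweight_texp hl, xweight_texp hl').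
case: hl hl' => -[_ lD lN] lpq [[_ lD' lN'] lpq'].
rewrite (@weighted_sum_rho_eval _ ((K - 4) * (\sum_r b r * l (T r) * l' (T r))
    + (\sum_r b r) * (\sum_r l (T r) * l' (T r))
    + (\sum_r l (T r)) * (\sum_r b r * l' (T r))
    + (\sum_r l' (T r)) * (\sum_r b r * l (T r)))
  zero zero (fun j => l (y j) * l' (y j)) (fun j => -2 * (l (y j) * l' (y j)))
    (fun j => l' (y j)) (fun j => l (y j))
  zero zero zero (fun j => 2 * (l (z j) * l' (z j))) zero zero
  (fun r => 2 * (b r * l (T r) * l' (T r)))
  (fun r => l (T r) * l' (T r) + - 2 * (b r * l (T r) * l' (T r)))
  (fun r => b r) zero zero
  (fun r => b r) (fun r => l (T r)) (fun r => l' (T r))) /zero.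
- by rewrite !big_split/= -!mulr_sumr tl tl' sum_b !big1_eq K_E; ring.
- rewrite -pair_sum3; apply: eq_bigr => r _; apply: eq_bigr => s _.
  by rewrite lD lD'.
all: by move=> *; rewrite !(lD, lN, lD', lN') ?lpq ?lpq' /=; ring.
Qed.

Lemma rho_weight_b1 l : is_xweight l -> S (fun d => d.2 * l d)
  = (2 * n%:Z + 2) * (\sum_j l (y j)) - (4 * m%:Z + 2) * (\sum_r b r * l (T r)).
Proof.
move=> hl; have tl := xweight_texp hl; case: hl => -[_ lD lN] lpq.
rewrite (@weighted_sum_rho_eval _ ((K - 2) * (\sum_r b r * l (T r))
    + (\sum_r b r) * (\sum_r l (T r)))
  (fun j => -2 * l (y j)) (fun j => - 4 * l (y j)) (fun j => - 1 * l (y j)) zero zero zero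
  zero zero zero zero zero zero
  (fun r => 2 * (b r * l (T r))) (fun r => 2 * (b r * l (T r)) + - 1 * l (T r))
  zero zero zero zero zero zero) /zero.
- by rewrite !big_split/= -!mulr_sumr tl !big1_eq K_E; ring.
- by rewrite -pair_sum2; apply: eq_bigr => r _; apply: eq_bigr => s _; rewrite lD.
all: by move=> *; rewrite !(lD, lN) ?lpq /=; ring.
Qed.

(** The terms with b^2 cancel as in degree three; the y-terms get the coefficient K - 2 (m + 1) = 2
    n + 2, which combines the number of parameters with the balancing exponent. *)
Lemma rho_weight_bb l : is_xweight l ->
  S (fun d => d.2 * d.2 * l d) = S (fun d => d.2 * l d).
Proof.
move=> hl; rewrite [RHS]rho_weight_b1//.
have tl := xweight_texp hl; case: hl => -[_ lD lN] lpq.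
rewrite (@weighted_sum_rho_eval _ ((K - 4) * (\sum_r b r * b r * l (T r))
    + (\sum_r b r) * (\sum_r b r * l (T r))
    + (\sum_r b r) * (\sum_r b r * l (T r))
    + (\sum_r l (T r)) * (\sum_r b r * b r))
  zero zero (fun j => - 1 * l (y j)) (fun j => 2 * l (y j)) zero zero
  zero zero zero zero zero zero
  (fun r => 2 * (b r * b r * l (T r)))
  (fun r => - 2 * (b r * b r * l (T r)) + 2 * (b r * l (T r)) + - 1 * l (T r))
  zero zero zero (fun r => b r) zero zero) /zero.
- by rewrite !big_split/= -!mulr_sumr tl sum_b !big1_eq K_E; ring.
- by rewrite -pair_sum3; apply: eq_bigr => r _; apply: eq_bigr => s _; rewrite lD.
all: by move=> *; rewrite !(lD, lN) ?lpq /=; ring.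
Qed.

End RhoWeights.

(** * Vanishing of the multipliers of rho *)

Section RhoBalanced.
Variables (n m : nat).
Local Notation k := (2 * n + 2 * m + 3)%N.
Local Notation N := (n + m + k)%N.
Local Notation exponent := ('rV[int]_N * int)%type.
Local Notation T := (@texp n m).
Local Notation z := (@zexp n m).
Local Notation y := (@yexp n m).
Local Notation S := (weighted_sum (rho_list n m)).
Implicit Types (phi : exponent -> int) (a b c : 'I_N).

(** Binomial weights have denominators 2 and 6; after multiplication by x they become integer
    combinations of the monomial weights already evaluated. *)
Lemma weighted_sum_comb (L : seq (exponent * int)) (s : seq (int * (exponent -> int)))
    (x : int) phi :
  (forall d, x * phi d = \sum_(f <- s) f.1 * f.2 d) ->
  x * weighted_sum L phi = \sum_(f <- s) f.1 * weighted_sum L f.2.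
Proof.
move=> h; rewrite /weighted_sum mulr_sumr.
under [RHS]eq_bigr do rewrite mulr_sumr.
rewrite exchange_big/=; apply: eq_bigr => i _.
by rewrite mulrCA h mulr_sumr; apply: eq_bigr => f _; rewrite mulrCA.
Qed.

Lemma weighted_sum_ext (L : seq (exponent * int)) phi psi :
  (forall d, phi d = psi d) -> weighted_sum L phi = weighted_sum L psi.
Proof. by move=> h; apply: eq_bigr => i _; rewrite h. Qed.

Local Notation al a := (fun d : exponent => d.1 0 a).
Local Notation al2 a b := (fun d : exponent => d.1 0 a * d.1 0 b).
Local Notation al3 a b c := (fun d : exponent => d.1 0 a * d.1 0 b * d.1 0 c).
Local Notation be_al2 a b := (fun d : exponent => d.2 * d.1 0 a * d.1 0 b).
Local Notation be_al a := (fun d : exponent => d.2 * d.1 0 a).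
Local Notation be2_al a := (fun d : exponent => d.2 * d.2 * d.1 0 a).

Let xw a := @xweight_coord n m a.
Let w1 a : S (al a) = 0 := rho_weight1 (xw a).
Let w3 a b c : S (al3 a b c) = 0 := rho_weight3 (xw a) (xw b) (xw c).
Let wb2 a b : 2 * S (be_al2 a b) = S (al2 a b) := rho_weight_b2 (xw a) (xw b).
Let wbb a : S (be2_al a) = S (be_al a) := rho_weight_bb (xw a).

Lemma rho_balanced_p a b : trivial_multiplier (rho_list n m)
  (fun d => d.1 0 a * d.1 0 b) (fun d => binz2 (d.1 0 a) * d.1 0 b)
  (fun d => d.1 0 a * binz2 (d.1 0 b)).
Proof.
(* Exchanging a and b turns the condition on the exponent of q into that on the exponent of p, so
   one statement serves both. *)
have main a' b' : S (fun d => d.2 * (d.1 0 a' * d.1 0 b') + binz2 (d.1 0 a') * d.1 0 b') = 0.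
  apply: (@mulfI _ 2) => //.
  rewrite (@weighted_sum_comb _ [:: (2, be_al2 a' b'); (1, al3 a' a' b'); (-1, al2 a' b')]).
    by rewrite !big_cons big_nil /= w3 wb2; ring.
  move=> d; rewrite !big_cons big_nil /=.
  transitivity (2 * d.2 * d.1 0 a' * d.1 0 b' + (binz2 (d.1 0 a') * 2) * d.1 0 b').
    by ring.
  by rewrite binz2E; ring.
split.
- rewrite (rho_weight2 (xw a) (xw b)).
  exists ((2 * m%:Z + 2) * (\sum_j (z j).1 0 a * (z j).1 0 b)
    - (2 * n%:Z + 2) * (\sum_j (y j).1 0 a * (y j).1 0 b)
    - (2 * m%:Z + 1) * (\sum_r (T r).1 0 a * (T r).1 0 b)); ring.
- by move=> c; rewrite -(w3 c a b); apply: weighted_sum_ext => d; rewrite mulrA.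
- exact: main.
- by rewrite -(main b a); apply: weighted_sum_ext => d; ring.
Qed.

Lemma rho_balanced_q a : trivial_multiplier (rho_list n m)
  (fun d => d.1 0 a * d.2 + binz2 (d.1 0 a))
  (fun d => binz2 (d.1 0 a) * d.2 + (2 * binz3 (d.1 0 a) + binz2 (d.1 0 a)))
  (fun d => binz3 (d.2 + d.1 0 a) - binz3 d.2).
Proof.
split.
(* Half of the weighted sum, as computed from [rho_weight_b1] and [rho_weight2]. *)
- exists ((n%:Z + 1) * (\sum_j (y j).1 0 a)
    - (2 * m%:Z + 1) * (\sum_r (T r).2 * (T r).1 0 a)
    + (m%:Z + 1) * (\sum_j (z j).1 0 a * (z j).1 0 a)
    - (n%:Z + 1) * (\sum_j (y j).1 0 a * (y j).1 0 a)
    - (2 * m%:Z + 1) * (\sum_r binz2 ((T r).1 0 a))).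
  apply: (@mulfI _ 2) => //.
  rewrite (@weighted_sum_comb _ [:: (2, be_al a); (1, al2 a a); (-1, al a)]).
    rewrite !big_cons big_nil /= w1 (rho_weight_b1 (xw a)) (rho_weight2 (xw a) (xw a)).
    (* The coefficient 4 m + 2 of this sum is not divisible by 4. The missing factor 2 is found
       because the exponents of x_a in the t_r sum to 0, so that their squares may be replaced by
       the even numbers v (v - 1). *)
    have -> : \sum_r (T r).1 0 a * (T r).1 0 a = 2 * \sum_r binz2 ((T r).1 0 a).
      transitivity (\sum_r ((T r).1 0 a * (T r).1 0 a - (T r).1 0 a)).
        by rewrite sumrB (xweight_texp (xw a)) subr0.
      by rewrite mulr_sumr; apply: eq_bigr => r _; rewrite [2 * _]mulrC binz2E; ring.
    by ring.
  move=> d; rewrite !big_cons big_nil /= mulrDr [2 * binz2 _]mulrC binz2E; ring.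
- move=> c; apply: (@mulfI _ 2) => //.
  rewrite (@weighted_sum_comb _ [:: (2, be_al2 c a); (1, al3 c a a); (-1, al2 c a)]).
    by rewrite !big_cons big_nil /= w3 wb2; ring.
  move=> d; rewrite !big_cons big_nil /=.
  transitivity (2 * d.2 * d.1 0 c * d.1 0 a + d.1 0 c * (binz2 (d.1 0 a) * 2)).
    by ring.
  by rewrite binz2E; ring.
- apply: (@mulfI _ 6) => //.
  (* The cubic and linear weights sum to 0, the pair 6, -3 cancels by [wb2], and the pair 6, -6 by
     [wbb]. *)
  rewrite (@weighted_sum_comb _ [:: (2, al3 a a a); (6, be_al2 a a); (-3, al2 a a);
      (6, be2_al a); (-6, be_al a); (1, al a)]).
    by rewrite !big_cons big_nil /= w3 w1 wbb -wb2; ring.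
  move=> d; rewrite !big_cons big_nil /=.
  transitivity (6 * d.2 * d.1 0 a * d.2 + 6 * d.2 * (binz2 (d.1 0 a) * 2)
    + 2 * (binz3 (d.1 0 a) * 6) + 3 * (binz2 (d.1 0 a) * 2)); first by ring.
  by rewrite binz2E binz3E; ring.
- apply: (@mulfI _ 6) => //.
  rewrite (@weighted_sum_comb _ [:: (1, al3 a a a); (6, be_al2 a a); (-3, al2 a a);
      (9, be2_al a); (-9, be_al a); (2, al a)]).
    by rewrite !big_cons big_nil /= w3 w1 wbb -wb2; ring.
  move=> d; rewrite !big_cons big_nil /=.
  transitivity (6 * d.2 * d.1 0 a * d.2 + 3 * d.2 * (binz2 (d.1 0 a) * 2)
    + (binz3 (d.2 + d.1 0 a) * 6) - (binz3 d.2 * 6)); first by ring.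
  by rewrite binz2E !binz3E; ring.
Qed.

Lemma exponent_neq0 (j : 'I_N) (d : exponent) : d.1 0 j != 0 -> d.1 != 0.
Proof. by apply: contraNneq => ->; rewrite mxE. Qed.

Local Notation zco i := (lshift k (lshift m i)).
Local Notation yco j := (lshift k (rshift n j)).
Local Notation tco s := (rshift (n + m) s).

Lemma zexp_z i i' : (z i).1 0 (zco i') = (i == i')%:R.
Proof. by rewrite mxE eqxx /= !eq_lshift eq_sym. Qed.

Lemma yexp_y j j' : (y j).1 0 (yco j') = (j == j')%:R.
Proof. by rewrite mxE eqxx /= eq_lshift eq_rshift eq_sym. Qed.

Lemma texp_l r (j : 'I_(n + m)) : (T r).1 0 (lshift k j) = 0.
Proof.
rewrite /texp; case: unliftP => [s _|_]; first by rewrite mxE eqxx eq_lrshift.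
have [hl l0] := xw (lshift k j); case: (hl) => [_ lD lN].
rewrite lD lN (is_linear_muln (pqexp n m) m.+1 hl) l0 mulr0 add0r.
rewrite (is_linear_sum (index_enum 'I_k) (fun s => unitexp (tco s)) hl) big1 ?oppr0// => s _.
by rewrite mxE eqxx eq_lrshift.
Qed.

Lemma texp_t r s : (T r).1 0 (tco s) =
  if unlift ord_max r is Some s' then (s' == s)%:R else - 1.
Proof.
rewrite /texp; case: unliftP => [s' _|_]; first by rewrite mxE eqxx /= eq_rshift eq_sym.
have [hl l0] := xw (tco s); case: (hl) => [_ lD lN].
rewrite lD lN (is_linear_muln (pqexp n m) m.+1 hl) l0 mulr0 add0r.
rewrite (is_linear_sum (index_enum 'I_k) (fun s => unitexp (tco s)) hl) (bigD1 s)//= mxE !eqxx.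
rewrite big1 ?addr0// => s' ss'.
by rewrite mxE eqxx /= eq_rshift eq_sym (negbTE ss').
Qed.

(** Each monomial is tested at one coordinate with nonzero exponent: that of a z or y where one
    occurs, that of a t in the products t_r t_s. *)
Lemma nonconstant_rho : nonconstant (rho_list n m).
Proof.
have ltF l (i j : 'I_l) : (i < j)%N -> (i == j) = false /\ (j == i) = false.
  by move=> ij; rewrite -!val_eqE ltn_eqF// gtn_eqF.
rewrite /rho_list /nonconstant !all_cat -!/(nonconstant _) !nonconstant_inv.
apply/and3P; split; last (apply/andP; split).
- apply: nonconstant_bigcat => r _; apply: nonconstant_bigcat => s rs.
  rewrite nonconstant_inv; apply/andP; split=> //.
  have [r' rE] : exists r', unlift ord_max r = Some r'.
    case: unliftP => [r' _|rE]; first by exists r'.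
    by move: rs; rewrite rE /= ltnNge -ltnS ltn_ord.
  case sE : (unlift ord_max s) => [s'|].
    apply: (@exponent_neq0 (tco r') (T r + T s)); rewrite /= mxE !texp_t rE sE eqxx.
    by case: (s' == r').
  (* When s is the eliminated index, t_r drops out of t_r t_s. Every other independent parameter
     occurs there with exponent -1, and there are at least three independent ones. *)
  have [r'' rr] : exists r'' : 'I_k, r'' != r'.
    have h0 : (0 < k)%N by rewrite addn3.
    have h1 : (1 < k)%N by rewrite addn3.
    have [<-|] := eqVneq (Ordinal h0) r'; last by exists (Ordinal h0).
    by exists (Ordinal h1).
  apply: (@exponent_neq0 (tco r'') (T r + T s)); rewrite /= mxE !texp_t rE sE.
  by rewrite [r' == _]eq_sym (negbTE rr).
- apply/andP; split.
    apply: nonconstant_bigcat => i _; apply: nonconstant_bigcat => j /ltF[ij ji].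
    have [[_ lD lN] l0] := xw (yco i).
    rewrite !nonconstant_cons; apply/and5P; split=> //; apply: (@exponent_neq0 (yco i));
      by rewrite !(lD, lN) ?l0 !yexp_y eqxx ?ij ?ji.
  apply: nonconstant_bigcat => i _; apply: nonconstant_bigcat => j /ltF[ij ji].
  have [[_ lD lN] _] := xw (zco i).
  rewrite !nonconstant_cons; apply/and5P; split=> //; apply: (@exponent_neq0 (zco i));
    by rewrite !(lD, lN) !zexp_z eqxx ?ij ?ji.
- apply/andP; split.
    apply: nonconstant_bigcat => j _; have [[_ lD lN] l0] := xw (yco j).
    rewrite !nonconstant_cons; apply/and3P; split=> //; apply: (@exponent_neq0 (yco j));
      by rewrite !(lD, lN) ?l0 !yexp_y eqxx.
  apply: nonconstant_bigcat => j _; have [[_ lD lN] _] := xw (zco j).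
  rewrite !nonconstant_cons; apply/and3P; split=> //; apply: (@exponent_neq0 (zco j));
    by rewrite !(lD, lN) !zexp_z eqxx.
apply: nonconstant_bigcat => r _; rewrite /nonconstant all_cat -!/(nonconstant _).
rewrite nonconstant_inv; apply/andP; split.
  apply: nonconstant_bigcat => j _; have [[_ lD lN] _] := xw (zco j).
  rewrite !nonconstant_cons; apply/and3P; split=> //; apply: (@exponent_neq0 (zco j));
    by rewrite !(lD, lN) texp_l zexp_z eqxx.
apply: nonconstant_bigcat => j _; have [[_ lD lN] l0] := xw (yco j).
rewrite !nonconstant_cons; apply/and3P; split=> //; apply: (@exponent_neq0 (yco j));
  by rewrite !(lD, lN) ?l0 texp_l yexp_y eqxx.
Qed.

End RhoBalanced.

Theorem theorem8 (R : realType) (n m : nat) (p : R[i]) (hp : 0 < `|p| < 1) :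
  totally_elliptic_term p (rho_indep n m p).
Proof.
have [p0 p1] : p != 0 /\ nc p < 1.
  move: hp => /andP[]; rewrite normr_gt0 ncE => p0.
  by rewrite (_ : 1 = 1%:C) ?ltcR.
apply: (totally_elliptic_gamma_product p1 p0 (L := rho_list n m)).
- by move=> i /(allP (nonconstant_rho n m)).
- by move=> u Du; rewrite -gamma_of_rho.
- exact: rho_balanced_p.
- exact: rho_balanced_q.
Qed.
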